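(* For any orientation $\vec G$ of the Coxeter diagram of $B_n$, the Cambrian lattice $\mathcal C(\vec G)$ is a sublattice of the weak order on $B_n$: the set of elements that are minimal in their $\Theta(\vec G)$-class (which, as an induced subposet, is isomorphic to $\mathcal C(\vec G)$) is closed under the meet and join of the weak order on $B_n$.
   Context: $B_n$: signed permutations of $\pm[n]$ with Coxeter generators $s_0=(-1\ 1)$, $s_i=(i\ i{+}1)(-i{-}1\ {-i})$, $i\in[n-1]$; diagram $s_0\overset{4}{-}s_1-\cdots-s_{n-1}$. Weak order $v\le w$ iff $I(v)\subseteq I(w)$, $I(w)$ the set of reflections $t$ with $\ell(tw)<\ell(w)$; it is a lattice. $\Theta(\vec G)$: smallest lattice congruence of the weak order with $t$ congruent to the element with alternating word $tsts\cdots$ of $m(s,t)-1$ letters for each directed edge $s\to t$; congruence classes are intervals; $\mathcal C(\vec G)$ is the quotient lattice. *)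

(* Defs.v *)
From mathcomp Require Import all_boot all_fingroup.
Set Implicit Arguments. Unset Strict Implicit. Unset Printing Implicit Defensive.
Import GroupScope.

Section TypeB.
Variable n : nat.

(* The set +-[n]: (false, i) encodes i+1 and (true, i) encodes -(i+1). *)
Definition pmn : finType := (bool * 'I_n)%type.
Definition negpm (x : pmn) : pmn := (~~ x.1, x.2).

Definition Bn : {set {perm pmn}} :=
  [set w : {perm pmn} | [forall x : pmn, w (negpm x) == negpm (w x)]].

Definition ordpred (i : 'I_n) : 'I_n :=
  Ordinal (leq_ltn_trans (leq_pred i) (ltn_ord i)).

(* Coxeter generators: gen 0 = s_0 = (-1 1);
   gen i = s_i = (i i+1)(-i-1 -i) for 1 <= i <= n-1
   (1-based value i is encoded by index i-1). *)
Definition gen (i : 'I_n) : {perm pmn} :=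
  if val i == 0 then tperm (false, i) (true, i)
  else tperm (false, ordpred i) (false, i) * tperm (true, ordpred i) (true, i).

Definition wprod (s : seq 'I_n) : {perm pmn} := \prod_(i <- s) gen i.

(* Coxeter length: least k such that w is a product of k generators
   (every element of B_n has length < #|{perm pmn}|). *)
Definition blen (w : {perm pmn}) : nat :=
  find (fun k => [exists s : k.-tuple 'I_n, wprod s == w]) (iota 0 #|{perm pmn}|).

Definition refls : {set {perm pmn}} :=
  [set (gen i) ^ w | i : 'I_n, w : {perm pmn} in Bn].

Definition inv_set (w : {perm pmn}) : {set {perm pmn}} :=
  [set t in refls | blen (t * w) < blen w].

Definition weak_le (v w : {perm pmn}) : bool := inv_set v \subset inv_set w.

Definition is_meet (x y m : {perm pmn}) : Prop :=
  [/\ m \in Bn, weak_le m x, weak_le m y &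
      forall z, z \in Bn -> weak_le z x -> weak_le z y -> weak_le z m].

Definition is_join (x y j : {perm pmn}) : Prop :=
  [/\ j \in Bn, weak_le x j, weak_le y j &
      forall z, z \in Bn -> weak_le x z -> weak_le y z -> weak_le j z].

Definition lattice_congruence (R : {perm pmn} -> {perm pmn} -> Prop) : Prop :=
  (forall x y, R x y -> x \in Bn /\ y \in Bn) /\
  [/\ forall x, x \in Bn -> R x x,
      forall x y, R x y -> R y x,
      forall x y z, R x y -> R y z -> R x z,
      forall x y z m m', z \in Bn -> R x y -> is_meet x z m -> is_meet y z m' -> R m m'
    & forall x y z j j', z \in Bn -> R x y -> is_join x z j -> is_join y z j' -> R j j'].

Definition cox_edge (i j : 'I_n) : bool := ((val i).+1 == val j) || ((val j).+1 == val i).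

Definition cox_m (i j : 'I_n) : nat :=
  if cox_edge i j then (if (val i == 0) || (val j == 0) then 4 else 3) else 2.

(* An orientation of the diagram: a relation D, D s t meaning s -> t. *)
Definition orientation (D : rel 'I_n) : Prop :=
  (forall i j, D i j -> cox_edge i j) /\
  (forall i j, cox_edge i j -> (D i j && ~~ D j i) || (D j i && ~~ D i j)).

Definition alt_word (a b : {perm pmn}) (k : nat) : {perm pmn} :=
  \prod_(l < k) (if odd l then b else a).

Definition Theta (D : rel 'I_n) (x y : {perm pmn}) : Prop :=
  forall R, lattice_congruence R ->
    (forall s t, D s t -> R (gen t) (alt_word (gen t) (gen s) (cox_m s t).-1)) ->
    R x y.

Definition theta_min (D : rel 'I_n) (x : {perm pmn}) : Prop :=
  x \in Bn /\ (forall y, y \in Bn -> Theta D y x -> weak_le y x -> y = x).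

End TypeB.

(* Main.v *)
Require Import Defs.
From mathcomp Require Import all_boot all_fingroup.
From mathcomp Require Import zify.
Set Implicit Arguments. Unset Strict Implicit. Unset Printing Implicit Defensive.
Import GroupScope.

(** View a signed permutation [w] as a permutation of the [2n]-element chain
    [-n < ... < -1 < 1 < ... < n]; the weak order is then inclusion of the sets
    of inverted pairs [a < c], [w c < w a], and these sets are exactly the
    biclosed sets of pairs that are stable under negation.

    The orientation colours every value [b] "upper" or not, with opposite colours
    for [b] and [-b].  Call [w] avoiding when [a < b < c], [b] upper and [(a, c)]
    inverted imply [(b, c)] inverted; by negation, [(a, b)] is then inverted when
    [b] is not upper.  Avoidance passes to joins and meets, because these are
    transitive closures of inversions and of non-inversions.

    Avoiding elements are the bottoms of the classes.  On the one hand, "the same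
    avoiding elements lie below [x] and [y]" is a congruence containing the
    generating pairs: meets are clear, and the relation is self-dual, hence joins.
    On the other hand, if [c, a] are consecutive in [w] and an upper [b] in between
    precedes them, then exchanging [a] and [c] stays in the class: this is forced
    by the generator at [b], directly unless [-b] interferes, and otherwise after
    moving some [d] between [c] and [a] and using the hexagon so created. *)

(** * Adjacent transpositions of a chain, made symmetric under its reversal *)

Section MirrorSwap.
Variables N k p : nat.

(* Exchanges [k] with [k + 1], and their mirror images under [p |-> N - 1 - p]. *)
Definition mirror_swap : nat :=
  if p == k then k + 1 else if p == k + 1 then k
  else if p + k + 2 == N then p + 1 else if p + k + 1 == N then p - 1 else p.

Lemma mirror_swap1 : p = k -> mirror_swap = k + 1.
Proof. by rewrite /mirror_swap => ->; rewrite eqxx. Qed.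

Lemma mirror_swap2 : p = k + 1 -> mirror_swap = k.
Proof. by rewrite /mirror_swap => ->; rewrite eqxx; case: eqP => //; lia. Qed.

Lemma mirror_swap3 : p + k + 2 = N -> p <> k -> p <> k + 1 -> mirror_swap = p + 1.
Proof. by rewrite /mirror_swap => -> /eqP/negPf-> /eqP/negPf->; rewrite eqxx. Qed.

Lemma mirror_swap4 : p + k + 1 = N -> p <> k -> p <> k + 1 -> mirror_swap = p - 1.
Proof.
rewrite /mirror_swap => <- /eqP/negPf-> /eqP/negPf->.
by rewrite eqxx; case: eqP => //; lia.
Qed.

Lemma mirror_swap5 : p <> k -> p <> k + 1 -> p + k + 2 <> N -> p + k + 1 <> N ->
  mirror_swap = p.
Proof. by rewrite /mirror_swap => /eqP/negPf-> /eqP/negPf-> /eqP/negPf-> /eqP/negPf->. Qed.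
End MirrorSwap.

Lemma mirror_swapC n k k' p : k + k' + 2 = n + n ->
  mirror_swap (n + n) k p = mirror_swap (n + n) k' p.
Proof.
move=> e; have [->//|nk] := eqVneq k k'.
have [?|?] := eqVneq p k; first by rewrite mirror_swap1 // mirror_swap3; lia.
have [?|?] := eqVneq p (k + 1); first by rewrite mirror_swap2 // mirror_swap4; lia.
have [?|?] := eqVneq p k'; first by rewrite mirror_swap3 ?mirror_swap1; lia.
have [?|?] := eqVneq p (k' + 1); first by rewrite mirror_swap4 ?mirror_swap2; lia.
by rewrite !mirror_swap5; lia.
Qed.

(** * The weak order as inclusion of sets of inverted pairs *)

Section Order.
Variable n : nat.
Implicit Types (u v a b c d : pmn n) (w x y z : {perm pmn n}).

(* Index of [u] in the chain [-n < ... < -1 < 1 < ... < n], counted from 0. *)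
Definition V (u : pmn n) : nat := if u.1 then n.-1 - u.2 else n + u.2.

Lemma V_lt u : V u < n + n.
Proof. case: u => -[] [i hi]; rewrite /V /=; lia. Qed.

Lemma V_inj : injective V.
Proof.
move=> [s [i hi]] [s' [j hj]]; rewrite /V.
by case: s; case: s' => /= e; try (exfalso; lia); congr (_, _); apply: val_inj => /=; lia.
Qed.

Lemma V_eq u v : (u == v) = (V u == V v).
Proof. by rewrite (inj_eq V_inj). Qed.

Lemma V_neg u : V (negpm u) + V u + 1 = n + n.
Proof. case: u => -[] [i hi]; rewrite /V /negpm /=; lia. Qed.

Lemma V_surj k : k < n + n -> exists u, V u = k.
Proof.
move=> hk; case: (ltnP k n) => h.
  have h' : n.-1 - k < n by lia.
  by exists (true, Ordinal h'); rewrite /V /=; lia.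
have h' : k - n < n by lia.
by exists (false, Ordinal h'); rewrite /V /=; lia.
Qed.

Lemma negpmK : involutive (@negpm n).
Proof. by case=> s i; rewrite /negpm /= negbK. Qed.

Lemma negpm_inj : injective (@negpm n).
Proof. exact: inv_inj negpmK. Qed.

Lemma negpm_neq u : (negpm u == u) = false.
Proof. by case: u => -[] i; apply/eqP => -[]. Qed.

(** * The group, its reflections and its inverted pairs *)

Lemma BnP w : reflect (forall u, w (negpm u) = negpm (w u)) (w \in Bn n).
Proof. by rewrite inE; apply: forallPP => u; apply: eqP. Qed.

Lemma Bn1 : 1 \in Bn n.
Proof. by apply/BnP => u; rewrite !perm1. Qed.

Lemma BnM x y : x \in Bn n -> y \in Bn n -> x * y \in Bn n.
Proof. by move=> /BnP hx /BnP hy; apply/BnP => u; rewrite !permM hx hy. Qed.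

Lemma BnV x : x \in Bn n -> x^-1 \in Bn n.
Proof. by move=> /BnP hx; apply/BnP => u; apply: (@perm_inj _ x); rewrite hx !permKV. Qed.

(** When [b] is [negpm a] the two transpositions coincide and would cancel, so only one is taken. *)
Definition tref a b : {perm pmn n} :=
  if b == negpm a then tperm a b else tperm a b * tperm (negpm a) (negpm b).

Lemma trefE a b u : tref a b u =
  if u == a then b else if u == b then a else
  if u == negpm a then negpm b else if u == negpm b then negpm a else u.
Proof.
have hu := V_neg u; have ha := V_neg a; have hb := V_neg b.
rewrite /tref; case: eqVneq => [e|]; rewrite ?permM !permE /= !V_eq;
  [ | move=> nba]; apply: V_inj; rewrite ?e ?negpmK;
  repeat case: eqP => //=; rewrite ?V_eq; lia.
Qed.

Lemma tref_Bn a b : tref a b \in Bn n.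
Proof.
apply/BnP => u; rewrite !trefE !V_eq.
have ha := V_neg a; have hb := V_neg b; have hu := V_neg u.
by apply: V_inj; repeat case: eqP => //=; rewrite ?negpmK; lia.
Qed.

Lemma trefJ w a b : w \in Bn n -> tref a b ^ w = tref (w a) (w b).
Proof.
move=> /BnP hw; apply/permP => u; rewrite -[u](permKV w) permJ.
by rewrite !trefE -!hw !(inj_eq perm_inj); do !case: ifP.
Qed.

Lemma trefK a b : tref a b * tref a b = 1.
Proof.
apply/permP => u; rewrite perm1 permM [tref a b u]trefE !V_eq; apply: V_inj.
have ha := V_neg a; have hb := V_neg b.
by repeat case: eqP => //=; rewrite trefE !V_eq; repeat case: eqP => //=; lia.
Qed.

Lemma gen_tref (i : 'I_n) :
  exists u v, [/\ gen i = tref u v, V v = V u + 1 & V v = n + i].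
Proof.
rewrite /gen; have hi := ltn_ord i; case: eqP => /= i0.
  exists (true, i), (false, i); split; rewrite /V /=; try lia.
  by rewrite /tref eqxx tpermC.
exists (false, ordpred i), (false, i); by split; rewrite /V /=; try lia.
Qed.

Lemma V_gen (i : 'I_n) u : V (gen i u) = mirror_swap (n + n) (n + i - 1) (V u).
Proof.
have [a [b [-> h1 h2]]] := gen_tref i.
have ha := V_neg a; have hb := V_neg b; have hi := ltn_ord i.
rewrite trefE !V_eq; case: eqP => [?|?]; first by rewrite mirror_swap1; lia.
case: eqP => [?|?]; first by rewrite mirror_swap2; lia.
have [i0|i0] := posnP i.
  by do 2 (case: eqP => [?|_]; first by lia); rewrite mirror_swap5; lia.
case: eqP => [?|?]; first by rewrite mirror_swap4; lia.
case: eqP => [?|?]; first by rewrite mirror_swap3; lia.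
by rewrite mirror_swap5; lia.
Qed.

Lemma gen_Bn (i : 'I_n) : gen i \in Bn n.
Proof. by have [a [b [-> _ _]]] := gen_tref i; apply: tref_Bn. Qed.

Lemma wprod_Bn s : @wprod n s \in Bn n.
Proof.
rewrite /wprod; elim/big_ind: _ => [|x y|i _]; [exact: Bn1 | exact: BnM | exact: gen_Bn].
Qed.

Lemma wprod_rcons s (i : 'I_n) : wprod (rcons s i) = wprod s * gen i.
Proof. by rewrite /wprod -cats1 big_cat big_seq1. Qed.

(** [a] is read as a value and [w a] as its position: [inv_set] multiplies by reflections on the
    left, and [(t * w) u = w (t u)]. *)
Definition inverted w a b : bool := (V a < V b) && (V (w b) < V (w a)).

Lemma inverted_lt w a b : inverted w a b -> V a < V b.
Proof. by case/andP. Qed.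

Lemma V_Bn w u : w \in Bn n -> V (w (negpm u)) + V (w u) + 1 = n + n.
Proof. by move=> /BnP ->; apply: V_neg. Qed.

Lemma inverted_neg w a b : w \in Bn n -> inverted w (negpm b) (negpm a) = inverted w a b.
Proof.
move=> hw; rewrite /inverted.
have := V_Bn a hw; have := V_Bn b hw; have := V_neg a; have := V_neg b; lia.
Qed.

Lemma gen_flip (i : 'I_n) u v :
  V u < V v -> V (gen i v) < V (gen i u) -> V v = V u + 1 /\ gen i = tref u v.
Proof.
have [a [b [-> h1 h2]]] := gen_tref i.
have ha := V_neg a; have hb := V_neg b.
move=> luv; rewrite !trefE !V_eq => h.
suff [[/V_inj -> /V_inj ->]|[/V_inj -> /V_inj ->]] :
  (V u = V a /\ V v = V b) \/ (V u = V (negpm b) /\ V v = V (negpm a)).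
- by split.
- split; first lia.
  apply/permP => x; rewrite !trefE !V_eq !negpmK; apply: V_inj.
  by repeat case: eqP => //=; lia.
by move: h; repeat case: eqP => //=; lia.
Qed.

(** Exchange property: at some letter the order of [a] and [b] turns around. By [gen_flip] that
    letter is the reflection in their current positions, so deleting it is multiplying the word by
    [tref a b] on the left. *)
Lemma word_exchange s a b : inverted (wprod s) a b ->
  tref a b \in refls n /\
  exists2 s' : seq 'I_n, wprod s' = tref a b * wprod s & (size s').+1 = size s.
Proof.
elim/last_ind: s => [|s i IHs].
  by rewrite /wprod big_nil /inverted !perm1; lia.
rewrite wprod_rcons => /andP[ab]; rewrite !permM => h.
have [h'|h'] := boolP (inverted (wprod s) a b).
  have [? [s' e es]] := IHs h'; split=> //.
  by exists (rcons s' i); rewrite ?wprod_rcons ?e ?mulgA // !size_rcons es.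
have lab : V (wprod s a) < V (wprod s b).
  have : wprod s a != wprod s b by rewrite (inj_eq perm_inj) V_eq; lia.
  by rewrite V_eq; move: h'; rewrite /inverted ab /=; lia.
have [_ e] := gen_flip lab h; have wB := wprod_Bn s.
have eJ : tref a b = gen i ^ (wprod s)^-1 by rewrite e -trefJ // -conjgM mulgV conjg1.
split; first by apply/imset2P; exists i (wprod s)^-1; rewrite ?BnV.
exists s; last by rewrite size_rcons.
have -> : tref a b * (wprod s * gen i) = wprod s * (gen i * gen i).
  by rewrite !mulgA [tref a b * _]conjgC trefJ // -e.
by rewrite {1}e {1}e trefK mulg1.
Qed.

(** * Recovering an element from its inverted pairs, and its length *)

Lemma V_card u : V u = #|[set v | V v < V u]|.
Proof.
have /fin_all_exists[f fV] : forall k : 'I_(n + n), exists u, V u = k.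
  by move=> k; apply: V_surj.
have fi : injective f by move=> i j e; apply: val_inj; rewrite /= -!fV e.
have lu := V_lt u.
pose g (k : 'I_(V u)) := f (widen_ord (ltnW lu) k).
have gi : injective g by move=> i j /fi /(congr1 val) /= /val_inj.
rewrite -[LHS]card_ord -(card_imset predT gi); apply: eq_card => v; rewrite inE.
apply/imsetP/idP => [[k _ ->]|lvu]; first by rewrite fV /=.
by exists (Ordinal lvu) => //; apply: V_inj; rewrite fV.
Qed.

Lemma V_perm_card w u : V (w u) = #|[set v | V (w v) < V (w u)]|.
Proof.
rewrite [LHS]V_card -[RHS](card_imset _ (@perm_inj _ w)); apply: eq_card => v; rewrite inE.
apply/idP/imsetP => [h|[v']]; last by rewrite inE => h ->.
by exists (w^-1 v); rewrite ?inE permKV.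
Qed.

(** The position of [u] is the number of values placed before it, and the inverted pairs tell which
    these are. *)
Lemma inverted_inj x y : inverted x =2 inverted y -> x = y.
Proof.
move=> e; apply/permP => u; apply: V_inj; rewrite (V_perm_card x u) (V_perm_card y u).
apply: eq_card => v; rewrite !inE.
have [->|/eqP nuv] := eqVneq v u; first by rewrite !ltnn.
have hx : x v <> x u by move/perm_inj.
have hy : y v <> y u by move/perm_inj.
move/eqP: nuv; move/eqP: hx; move/eqP: hy; rewrite !V_eq.
by have := e u v; have := e v u; rewrite /inverted; lia.
Qed.

Definition ninv w := #|[set p : pmn n * pmn n | inverted w p.1 p.2]|.

(** Take an inverted pair with closest positions: a value placed in between would form a closer one
    with [a] or [b]. *)
Lemma adjacent_inv w : w != 1 -> exists a b, inverted w a b /\ V (w a) = V (w b) + 1.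
Proof.
move=> w1; have [p hp|h] := pickP (fun p : pmn n * pmn n => inverted w p.1 p.2); last first.
  case/eqP: w1; apply: inverted_inj => a b.
  by rewrite (h (a, b)) /inverted !perm1; lia.
case: (@arg_minnP _ p (fun p : pmn n * pmn n => inverted w p.1 p.2)
  (fun p => V (w p.1) - V (w p.2)) hp) => -[a b] /= iab hmin.
exists a, b; split=> //; case/andP: (iab) => ab ba.
case: (leqP (V (w a)) (V (w b) + 1)) => [|h]; first lia.
have [v hv] := @V_surj (V (w b) + 1) ltac:(have := V_lt (w a); lia).
pose c := w^-1 v; have hc : V (w c) = V (w b) + 1 by rewrite permKV.
have cb : c != b by apply: contraTneq isT => e; move: hc; rewrite e; lia.
case: (ltnP (V a) (V c)) => ac.
  have := hmin (a, c); rewrite /= /inverted; lia.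
have := hmin (c, b); rewrite /= /inverted; lia.
Qed.

(** Sorting: the generator exchanging the positions of a consecutive inverted pair creates no
    inverted pair and destroys this one. *)
Lemma word_exists w : w \in Bn n -> exists2 s : seq 'I_n, wprod s = w & size s <= ninv w.
Proof.
elim/ltn_ind: {w}(ninv w) {-2}w (erefl (ninv w)) => k IHk w ek wB.
have [->|w1] := eqVneq w 1; first by exists [::]; rewrite // /wprod big_nil.
have [a [b [iab eV]]] := adjacent_inv w1; case/andP: (iab) => ab ba.
have [i ei] : exists i : 'I_n, V (gen i (w a)) = V (w b) /\ V (gen i (w b)) = V (w a).
  have la := V_lt (w a).
  case: (leqP n (V (w a))) => h.
    have hi : V (w a) - n < n by lia.
    exists (Ordinal hi); rewrite !V_gen /=; split; first by rewrite mirror_swap2; lia.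
    by rewrite mirror_swap1; lia.
  have hi : n - V (w a) < n by lia.
  exists (Ordinal hi); rewrite !V_gen /= (@mirror_swapC n _ (V (w b))); last lia.
  rewrite (@mirror_swapC n _ (V (w b))); last lia.
  by rewrite mirror_swap2 ?mirror_swap1; lia.
have sub : [set p | inverted (w * gen i) p.1 p.2] \proper [set p | inverted w p.1 p.2].
  apply/properP; split; last first.
    exists (a, b); rewrite inE //= /inverted !permM; lia.
  apply/subsetP => -[p q]; rewrite !inE /= /inverted !permM => /andP[pq h].
  rewrite pq /= ltnNge; apply/negP => h'.
  have {}h' : V (w p) < V (w q).
    have : w p != w q by rewrite (inj_eq perm_inj) V_eq; lia.
    rewrite V_eq; lia.
  have [_ e] := gen_flip h' h.
  suff [[/V_inj/perm_inj e1 /V_inj/perm_inj e2]|[e1 e2]] :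
    (V (w a) = V (w q) /\ V (w b) = V (w p)) \/
    (V (w a) = V (w (negpm p)) /\ V (w b) = V (w (negpm q))).
  - by move: ab pq; rewrite e1 e2; lia.
  - move: e1 e2 => /V_inj/perm_inj e1 /V_inj/perm_inj e2.
    by move: ab pq (V_neg p) (V_neg q); rewrite e1 e2; lia.
  case: ei; rewrite e !trefE !V_eq.
  have h1 := V_Bn p wB; have h2 := V_Bn q wB; have h3 := V_neg (w p).
  by have := V_neg (w q); repeat case: eqP => //=; lia.
have lt := proper_card sub; rewrite -/(ninv _) -/(ninv w) in lt.
have [s es szs] := IHk _ ltac:(rewrite -ek; exact: lt) _ erefl (BnM wB (gen_Bn i)).
exists (rcons s i); last by rewrite size_rcons; lia.
have [u [v [eg _ _]]] := gen_tref i.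
by rewrite wprod_rcons es -mulgA eg trefK mulg1.
Qed.

(** [blen] only searches lengths below the number of permutations, so the words of [word_exists]
    must be shorter. Ordered pairs of distinct values number at most [(2n)!], and decreasing ones
    are never inverted. *)
Lemma ninv_bound w : ninv w < #|{perm pmn n}|.
Proof.
apply: leq_trans (max_card (perm_on [set: pmn n])).
rewrite card_perm cardsT card_prod card_bool card_ord.
have [n0|n0] := posnP n.
  suff -> : ninv w = 0 by apply: fact_gt0.
  by apply: eq_card0 => -[[s [i hi]] b]; exfalso; lia.
have hN : (2 * n * (2 * n).-1 <= (2 * n)`!)%N.
  case E : (2 * n)%N => [|[|m]]; [lia | lia |].
  by rewrite !factS mulnA leq_pmulr ?fact_gt0.
apply: leq_trans hN.
pose dg := [set p : pmn n * pmn n | p.1 == p.2].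
have hdg : #|dg| = (2 * n)%N.
  have -> : (2 * n)%N = #|pmn n| by rewrite card_prod card_bool card_ord.
  rewrite -(card_imset predT (f := fun u => (u, u))); last by move=> u v [].
  apply: eq_card => -[u v]; rewrite inE /=.
  by apply/eqP/imsetP => [->|[x _ [-> ->]] //]; exists v.
have hC : #|~: dg| = (2 * n * (2 * n).-1)%N.
  have := cardsC dg; rewrite hdg card_prod card_prod card_bool card_ord; nia.
rewrite -hC; apply: proper_card; apply/properP; split.
  apply/subsetP => -[u v]; rewrite !inE /= => /inverted_lt.
  by apply: contraTneq => ->; lia.
have [u hu] := @V_surj 0 ltac:(lia); have [v hv] := @V_surj 1 ltac:(lia).
by exists (v, u); rewrite !inE /= /inverted ?V_eq hu hv.
Qed.

Lemma blen_min (s : seq 'I_n) : blen (wprod s) <= size s.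
Proof.
rewrite /blen; have [h|h] := ltnP (size s) #|{perm pmn n}|; last first.
  by apply: leq_trans h; rewrite -{2}[#|_|](size_iota 0) find_size.
rewrite leqNgt; apply/negP => hf.
have := before_find 0 hf; rewrite nth_iota //= => /existsP; case.
by exists (in_tuple s) => /=.
Qed.

Lemma blen_word w : w \in Bn n -> exists2 s : seq 'I_n, wprod s = w & size s = blen w.
Proof.
move=> wB; have [s es szs] := word_exists wB; have hb := ninv_bound w.
pose P k := [exists s : k.-tuple 'I_n, wprod s == w].
have hP : has P (iota 0 #|{perm pmn n}|).
  apply/hasP; exists (size s); first by rewrite mem_iota /=; lia.
  by apply/existsP; exists (in_tuple s) => /=; apply/eqP.
have := nth_find 0 hP; rewrite nth_iota /=; last by rewrite -{2}[#|_|](size_iota 0) -has_find.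
by case/existsP => t /eqP et; exists t; rewrite // size_tuple.
Qed.

(** If the pair is inverted, the exchange property shortens [w]; otherwise the pair is inverted in
    [tref a b * w], which is shortened to [w]. *)
Lemma mem_inv_set w a b : w \in Bn n -> V a < V b ->
  tref a b \in refls n -> (tref a b \in inv_set w) = inverted w a b.
Proof.
have main x : x \in Bn n -> inverted x a b -> blen (tref a b * x) < blen x.
  move=> xB ix; have [s es <-] := blen_word xB.
  rewrite -es in ix; have [_ [s' es' <-]] := word_exchange ix.
  by rewrite -es -es' ltnS blen_min.
move=> wB ab tr; rewrite inE tr /=; apply/idP/idP => [|/main]; last exact.
apply: contraLR => niw; rewrite -leqNgt ltnW //.
rewrite -{1}[w]mul1g -(trefK a b) -mulgA; apply: main.
  by rewrite BnM ?tref_Bn.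
rewrite /inverted ab /= !permM !trefE !V_eq eqxx.
have : w a != w b by rewrite (inj_eq perm_inj) V_eq; lia.
move: niw; rewrite /inverted V_eq; have -> /= : (V b == V a) = false by lia.
by rewrite eqxx; lia.
Qed.

Lemma refls_tref t : t \in refls n -> exists a b, V a < V b /\ t = tref a b.
Proof.
case/imset2P => i w _ wB ->; have [a [b [-> h _]]] := gen_tref i.
rewrite trefJ //; set u := w a; set v := w b.
have : V u != V v by rewrite -V_eq (inj_eq perm_inj) V_eq; lia.
rewrite neq_ltn => /orP[h'|h']; first by exists u, v.
exists v, u; split=> //; rewrite /tref -[v == _](inv_eq negpmK) eq_sym.
by rewrite tpermC [tperm (negpm _) _]tpermC.
Qed.

Definition le x y := forall a b, inverted x a b -> inverted y a b.

Lemma weak_leP x y : x \in Bn n -> y \in Bn n -> reflect (le x y) (weak_le x y).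
Proof.
move=> xB yB; apply: (iffP subsetP) => h.
  move=> a b iab; have ab := inverted_lt iab.
  have [s es _] := word_exists xB.
  have tr : tref a b \in refls n by move: iab; rewrite -es => /word_exchange[].
  by rewrite -(mem_inv_set yB ab tr) h // mem_inv_set.
move=> t ht; have tr : t \in refls n by move: ht; rewrite inE => /andP[].
have [a [b [ab et]]] := refls_tref tr; move: ht tr; rewrite et => ht tr.
by move: ht; rewrite !mem_inv_set //; apply: h.
Qed.

Lemma le_anti x y : le x y -> le y x -> x = y.
Proof. by move=> xy yx; apply: inverted_inj => a b; apply/idP/idP; [apply: xy | apply: yx]. Qed.

End Order.

(** * Joins and meets *)

Section Lattice.
Variable n : nat.
Implicit Types (u v a b c d : pmn n) (w x y z : {perm pmn n}).

(** Each [u] goes to its number of predecessors; negation reverses [r], so [u] and [negpm u] get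
    complementary ranks. *)
Lemma order_perm (r : rel (pmn n)) :
  irreflexive r -> transitive r -> (forall u v, u != v -> r u v || r v u) ->
  (forall u v, r u v -> r (negpm v) (negpm u)) ->
  exists2 w, w \in Bn n & forall u v, (V (w u) < V (w v)) = r u v.
Proof.
move=> rI rT rtot rN.
pose k u := #|[set v | r v u]|.
have kN u : k (negpm u) + k u + 1 = n + n.
  have -> : k (negpm u) = #|[set v | r u v]|.
    rewrite /k -[RHS](card_imset _ (@negpm_inj n)); apply: eq_card => v; rewrite inE.
    apply/idP/imsetP => [/rN h|[v']]; last by rewrite inE => /rN h ->.
    by exists (negpm v); rewrite ?inE ?negpmK // -[u]negpmK.
  have := cardsC [set v | r u v]; rewrite card_prod card_bool card_ord.
  suff -> : ~: [set v | r u v] = u |: [set v | r v u].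
    by rewrite cardsU1 inE rI /= /k mul2n -addnn => <-; rewrite -addnA (addnC _ 1%N).
  apply/setP => v; rewrite !inE; have [->|/rtot] := eqVneq v u; first by rewrite rI.
  by case uv: (r u v); case vu: (r v u) => //=; have := rT _ _ _ uv vu; rewrite rI.
have kr u v : r u v -> k u < k v.
  move=> uv; apply: proper_card; apply/properP; split.
    by apply/subsetP => t; rewrite !inE => tu; apply: rT uv.
  by exists u; rewrite inE // rI.
have krE u v : (k u < k v) = r u v.
  apply/idP/idP => [|/kr //]; have [->|] := eqVneq u v; first by rewrite ltnn.
  by case/rtot/orP => // /kr; lia.
have /fin_all_exists[f fV] : forall u, exists v, V v = k u.
  by move=> u; apply: V_surj; have := kN u; lia.
have fi : injective f.
  move=> u v /(congr1 (@V n)); rewrite !fV => e; apply/eqP; apply: contraT => /rtot.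
  by rewrite -!krE e ltnn.
exists (perm fi); last by move=> u v; rewrite !permE !fV krE.
apply/BnP => u; rewrite !permE; apply: V_inj.
by have := kN u; have := V_neg (f u); rewrite !fV; lia.
Qed.

Lemma key_perm (k : pmn n -> nat) : injective k ->
  (forall u v, k u < k v -> k (negpm v) < k (negpm u)) ->
  exists2 w, w \in Bn n & forall u v, (V (w u) < V (w v)) = (k u < k v).
Proof.
move=> ki kN; apply: (@order_perm (fun u v => k u < k v)) => //.
- by move=> u; rewrite ltnn.
- by move=> v u w; apply: ltn_trans.
- by move=> u v; rewrite -(inj_eq ki) neq_ltn.
Qed.

(** [J] prescribes the order of positions: values stay in order unless their pair is in [J].
    Transitivity of [J] and of its complement makes this a linear order. *)
Lemma biclosed_inv (J : rel (pmn n)) :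
  (forall a b, J a b -> V a < V b) -> transitive J ->
  (forall a b c, V a < V b -> V b < V c -> J a c -> J a b || J b c) ->
  (forall a b, J a b -> J (negpm b) (negpm a)) ->
  exists2 w, w \in Bn n & inverted w =2 J.
Proof.
move=> Jlt Jtr Jco JN.
have JNE a b : J (negpm b) (negpm a) = J a b.
  by apply/idP/idP => /JN //; rewrite !negpmK.
pose r u v := ((V u < V v) && ~~ J u v) || J v u.
have rE u v : u != v -> r u v = ~~ r v u.
  rewrite V_eq /r; case uv: (J u v); case vu: (J v u); rewrite ?orbT //=;
  try have := Jlt _ _ uv; try have := Jlt _ _ vu; lia.
have r1 u : r u u = false.
  by rewrite /r ltnn; apply/negP => /Jlt; rewrite ltnn.
have [] := @order_perm r.
- exact: r1.
- move=> v u w uv vw.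
  have nuv : u != v by apply: contraTneq uv => ->; rewrite r1.
  have nvw : v != w by apply: contraTneq vw => ->; rewrite r1.
  have nuw : u != w by apply: contraTneq uv => e; rewrite rE // negbK e.
  rewrite !V_eq in nuv nvw nuw.
  move: uv vw; rewrite /r.
  have T a b c := @Jtr b a c.
  have := T u v w; have := T v w u; have := T w u v.
  have := T u w v; have := T w v u; have := T v u w.
  have := Jco u v w; have := Jco v w u; have := Jco w u v.
  have := Jco u w v; have := Jco w v u; have := Jco v u w.
  have := Jlt u v; have := Jlt v w; have := Jlt u w.
  have := Jlt v u; have := Jlt w v; have := Jlt w u.
  by case: (J u v); case: (J v u); case: (J u w);
    case: (J w u); case: (J v w); case: (J w v) => //=; lia.
- move=> u v nuv; case h : (r u v) => //=; by rewrite rE ?h // eq_sym.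
- move=> u v; rewrite /r !JNE; have := V_neg u; have := V_neg v; lia.
move=> w wB wr; exists w => // a b; rewrite /inverted wr /r.
by case ab: (J a b); [rewrite (Jlt _ _ ab) orbT | rewrite orbF; case: ltngtP].
Qed.

Lemma inverted_trans w a b c : inverted w a b -> inverted w b c -> inverted w a c.
Proof. by rewrite /inverted; lia. Qed.

Lemma inverted_cotrans w a b c : V a < V b -> V b < V c ->
  inverted w a c -> inverted w a b || inverted w b c.
Proof.
move=> ab bc; rewrite /inverted ab bc (ltn_trans ab bc) /= => h.
have : w a != w b by rewrite (inj_eq perm_inj) V_eq; lia.
by rewrite V_eq; lia.
Qed.

Definition join_rel x y : rel (pmn n) := fun a b => inverted x a b || inverted y a b.

Lemma join_rel_le x y a b : connect (join_rel x y) a b -> V a <= V b.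
Proof.
case/connectP => p; elim: p a => [|v p IHp] a /=; first by move=> _ ->.
by case/andP => /orP[] /inverted_lt av /IHp h /h; lia.
Qed.

(** The transitive closure of the union is biclosed. The strict inequality removes the reflexive
    pairs of [connect]. *)
Lemma join_exists x y : x \in Bn n -> y \in Bn n ->
  exists j, [/\ j \in Bn n, le x j, le y j,
    forall z, le x z -> le y z -> le j z &
    forall a b, inverted j a b = (V a < V b) && connect (join_rel x y) a b].
Proof.
move=> xB yB; have [] := @biclosed_inv (fun a b => (V a < V b) && connect (join_rel x y) a b).
- by move=> a b /andP[].
- move=> b a c /andP[ab h1] /andP[bc h2].
  by rewrite (ltn_trans ab bc) (connect_trans h1 h2).
- move=> a b c ab bc /andP[_ /connectP[p]]; rewrite ab bc /=.
  elim: p a ab => [|v p IHp] a ab /=; first by move=> _ e; move: ab bc; rewrite e; lia.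
  case/andP => av pv e; have vc : connect (join_rel x y) v c by apply/connectP; exists p.
  (* Follow the path until a step reaches or passes [b]; a passing step splits at [b] by
     cotransitivity in [x] or [y]. *)
  have [vb|bv|/V_inj <-] := ltngtP (V v) (V b).
  + case/orP: (IHp v vb pv e) => [h|->]; last by rewrite orbT.
    by rewrite (connect_trans (connect1 av) h).
  + have : inverted x a b || inverted y a b || (inverted x b v || inverted y b v).
      by case/orP: av => /(inverted_cotrans ab bv)/orP[] ->; rewrite ?orbT.
    case/orP=> [h|h]; first by rewrite (@connect1 _ (join_rel x y) a b).
    by rewrite (connect_trans (@connect1 _ (join_rel x y) b v h) vc) orbT.
  + by rewrite connect1.
- move=> a b /andP[ab /connectP[p]].
  have lab : V (negpm b) < V (negpm a) by have := V_neg a; have := V_neg b; lia.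
  rewrite lab /= => {ab lab}; elim: p a => [|v p IHp] a /=; first by move=> _ ->.
  case/andP => av pv e; apply: connect_trans (IHp v pv e) _; apply: connect1.
  by rewrite /join_rel !inverted_neg.
move=> j jB jE; exists j; split=> //.
- by move=> a b h; rewrite jE (inverted_lt h) connect1 // /join_rel h.
- by move=> a b h; rewrite jE (inverted_lt h) connect1 // /join_rel h orbT.
move=> z xz yz a b; rewrite jE => /andP[ab /connectP[p]].
elim: p a ab => [|v p IHp] a ab /=; first by move=> _ e; move: ab; rewrite e ltnn.
case/andP => av pv e.
have {}av : inverted z a v by case/orP: av; [apply: xz | apply: yz].
have := @join_rel_le x y v b; rewrite leq_eqVlt => /(_ _)/orP[].
- by apply/connectP; exists p.
- by move/eqP/V_inj => <-.
by move=> vb; apply: inverted_trans av (IHp v vb pv e).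
Qed.

(** Multiplication by the longest element: it reverses positions, hence complements the inverted
    pairs and exchanges joins with meets. *)
Definition opp x : {perm pmn n} := x * perm (@negpm_inj n).

Lemma opp_Bn x : x \in Bn n -> opp x \in Bn n.
Proof. by move=> xB; apply: BnM => //; apply/BnP => u; rewrite !permE. Qed.

Lemma oppK : involutive opp.
Proof. by move=> x; apply/permP => u; rewrite !permM !permE negpmK. Qed.

Lemma inverted_opp x a b : inverted (opp x) a b = (V a < V b) && ~~ inverted x a b.
Proof.
rewrite /inverted !permM !permE; have := V_neg (x a); have := V_neg (x b).
have [->|] := eqVneq a b; first by rewrite !ltnn.
by rewrite -(inj_eq (@perm_inj _ x)) V_eq; lia.
Qed.

Lemma le_opp x y : le x y -> le (opp y) (opp x).
Proof.
move=> xy a b; rewrite !inverted_opp => /andP[-> /=]; apply: contra; exact: xy.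
Qed.

Lemma meet_exists x y : x \in Bn n -> y \in Bn n ->
  exists m, [/\ m \in Bn n, le m x, le m y,
    forall z, le z x -> le z y -> le z m &
    forall a b, inverted m a b =
      (V a < V b) && ~~ connect (join_rel (opp x) (opp y)) a b].
Proof.
move=> xB yB; have [j [jB xj yj jmin jE]] := join_exists (opp_Bn xB) (opp_Bn yB).
exists (opp j); split; first exact: opp_Bn.
- by rewrite -[x]oppK; apply: le_opp.
- by rewrite -[y]oppK; apply: le_opp.
- by move=> z zx zy; rewrite -[z]oppK; apply/le_opp/jmin; apply: le_opp.
- by move=> a b; rewrite inverted_opp jE; case: (V a < V b).
Qed.

Lemma weak_le_iff x y : x \in Bn n -> y \in Bn n -> weak_le x y <-> le x y.
Proof. by move=> xB yB; split=> /(weak_leP xB yB). Qed.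

Lemma is_meetP x y m : x \in Bn n -> y \in Bn n ->
  is_meet x y m <->
  [/\ m \in Bn n, le m x, le m y & forall z, z \in Bn n -> le z x -> le z y -> le z m].
Proof.
have lP := weak_le_iff.
move=> xB yB; split=> -[mB h1 h2 h3].
  split; [exact: mB | by apply/lP | by apply/lP | move=> z zB zx zy].
  by apply/(lP z m zB mB)/h3; [exact: zB | apply/(lP z x zB xB) | apply/(lP z y zB yB)].
split; [exact: mB | by apply/lP | by apply/lP | move=> z zB].
by move=> /(lP z x zB xB) zx /(lP z y zB yB) zy; apply/(lP z m zB mB)/h3.
Qed.

Lemma is_joinP x y j : x \in Bn n -> y \in Bn n ->
  is_join x y j <->
  [/\ j \in Bn n, le x j, le y j & forall z, z \in Bn n -> le x z -> le y z -> le j z].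
Proof.
have lP := weak_le_iff.
move=> xB yB; split=> -[jB h1 h2 h3].
  split; [exact: jB | by apply/lP | by apply/lP | move=> z zB xz yz].
  by apply/(lP j z jB zB)/h3; [exact: zB | apply/(lP x z xB zB) | apply/(lP y z yB zB)].
split; [exact: jB | by apply/lP | by apply/lP | move=> z zB].
by move=> /(lP x z xB zB) xz /(lP y z yB zB) yz; apply/(lP j z jB zB)/h3.
Qed.

Lemma is_join_opp x y j : x \in Bn n -> y \in Bn n ->
  is_join x y j -> is_meet (opp x) (opp y) (opp j).
Proof.
move=> xB yB /(is_joinP j xB yB)[jB xj yj h].
apply/(is_meetP (opp j) (opp_Bn xB) (opp_Bn yB)).
split; [exact: opp_Bn | exact: le_opp | exact: le_opp |].
move=> z zB zx zy; rewrite -[z]oppK; apply: le_opp; apply: h; rewrite ?opp_Bn //.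
  by rewrite -[x]oppK; apply: le_opp.
by rewrite -[y]oppK; apply: le_opp.
Qed.

End Lattice.

(** * Avoiding elements *)

Section Avoid.
Variables (n : nat) (U : pred (pmn n)).
Hypothesis UN : forall u, U (negpm u) = ~~ U u.
Implicit Types (u v a b c d : pmn n) (w x y z : {perm pmn n}).

Definition avoid x := forall a b c,
  V a < V b -> V b < V c -> U b -> inverted x a c -> inverted x b c.

Lemma avoid_right x a b c : x \in Bn n -> avoid x ->
  V a < V b -> V b < V c -> ~~ U b -> inverted x a c -> inverted x a b.
Proof.
move=> xB xA ab bc nb; rewrite -inverted_neg // -[inverted x a b]inverted_neg //.
apply: xA; rewrite ?UN //; have := V_neg a; have := V_neg b; have := V_neg c; lia.
Qed.

(** A path of non-inversions from [b] to [c] can be made to start at [a] instead: avoidance turns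
    its first step [(b, v)] into a non-inversion [(a, v)]. *)
Lemma avoid_meet x y m : x \in Bn n -> y \in Bn n -> avoid x -> avoid y ->
  is_meet x y m -> avoid m.
Proof.
move=> xB yB xA yA /is_meetP[] // mB mx my mmax.
have [m' [m'B m'x m'y m'max mE]] := meet_exists xB yB.
have {mmax m'max} -> : m = m' by apply: le_anti; [apply: m'max | apply: mmax].
move=> a b c ab bc Ub; rewrite !mE bc (ltn_trans ab bc) /=; apply: contra.
case/connectP => -[|v p] /=; first by move=> _ e; move: bc; rewrite e ltnn.
case/andP => bv pv e.
have vc : connect (join_rel (opp x) (opp y)) v c by apply/connectP; exists p.
apply: connect_trans (connect1 _) vc.
move: bv; rewrite /join_rel !inverted_opp -!andb_orr => /andP[lbv].
rewrite (ltn_trans ab lbv) /= => /orP[h|h]; apply/orP; [left|right].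
  by apply: contra h; apply: xA.
by apply: contra h; apply: yA.
Qed.

(** The last clause records, for each pair missing from [y], a consequence of it missing from [x];
    the duality argument relies on it. *)
Lemma largest_avoid x : x \in Bn n -> exists y, [/\ y \in Bn n, avoid y, le y x,
  forall z, z \in Bn n -> avoid z -> le z x -> le z y &
  forall a c, V a < V c -> ~~ inverted y a c -> exists a' c',
    [/\ (a' = a \/ V a < V a' /\ U a'), (c' = c \/ V c' < V c /\ ~~ U c'),
        V a' < V c' & ~~ inverted x a' c']].
Proof.
move=> xB.
(* Avoidance propagates an inversion (a, c) to (b, c) for upper b and to (a, b)
   for the others, so (a, c) is kept when all its consequences are inverted in x. *)
pose J a c := (V a < V c) && [forall a', forall c',
  [&& (a' == a) || (V a < V a') && U a', (c' == c) || (V c' < V c) && ~~ U c' & V a' < V c']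
  ==> inverted x a' c'].
have JP a c : reflect (V a < V c /\ forall a' c', (a' = a \/ V a < V a' /\ U a') ->
    (c' = c \/ V c' < V c /\ ~~ U c') -> V a' < V c' -> inverted x a' c') (J a c).
  apply: (iffP andP) => -[ac h]; split=> //.
    move=> a' c' ha hc lac; move/forallP/(_ a')/forallP/(_ c')/implyP: h; apply.
    rewrite lac andbT; apply/andP; split.
      by case: ha => [->|[-> ->]]; rewrite ?eqxx ?orbT.
    by case: hc => [->|[-> ->]]; rewrite ?eqxx ?orbT.
  apply/forallP => a'; apply/forallP => c'; apply/implyP => /and3P[ha hc lac].
  apply: h => //.
    by case/orP: ha => [/eqP|/andP]; [left | right].
  by case/orP: hc => [/eqP|/andP]; [left | right].
have JU a b c : V a < V b -> V b < V c -> U b -> J a c -> J b c.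
  move=> ab bc Ub /JP[_ h]; apply/JP; split=> // a' c' ha hc; apply: h => //.
  by case: ha => [->|[lb Ua]]; right; split=> //; lia.
have JL a b c : V a < V b -> V b < V c -> ~~ U b -> J a c -> J a b.
  move=> ab bc Ub /JP[_ h]; apply/JP; split=> // a' c' ha hc; apply: h => //.
  by case: hc => [->|[lb Ua]]; right; split=> //; lia.
have [] := @biclosed_inv n J.
- by move=> a b /andP[].
- move=> b a c /JP[ab h1] /JP[bc h2]; apply/JP; split; first lia.
  move=> a' c' ha hc lac.
  (* A consequence of [(a, c)] is one of [(a, b)] or of [(b, c)], unless [b] separates [a'] from
     [c']; then it splits into one of each. *)
  have [h|h] := leqP (V c') (V b).
    apply: h1 => //; move: h; rewrite leq_eqVlt => /orP[/eqP/V_inj ->|h]; first by left.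
    by right; split=> //; case: hc => [e|[]//]; move: h; rewrite e; lia.
  have [h'|h'] := leqP (V b) (V a').
    apply: h2 => //; move: h'; rewrite leq_eqVlt => /orP[/eqP/V_inj ->|h']; first by left.
    by right; split=> //; case: ha => [e|[]//]; move: h'; rewrite e; lia.
  apply: (@inverted_trans _ _ _ b); [apply: h1 => //; by left | apply: h2 => //; by left].
- move=> a b c ab bc Jac; case Ub: (U b).
    by rewrite (JU _ _ _ ab bc Ub Jac) orbT.
  by rewrite (JL _ _ _ ab bc _ Jac) // Ub.
- move=> a c /JP[ac h]; have ha := V_neg a; have hc := V_neg c.
  apply/JP; split=> [|a' c' ha' hc' lac]; first lia.
  have la' := V_neg a'; have lc' := V_neg c'.
  rewrite -inverted_neg //; apply: h; last lia.
    case: hc' => [->|[l u]]; [left; exact: negpmK | right; split; [lia | by rewrite UN]].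
  case: ha' => [->|[l u]]; [left; exact: negpmK | right; split; [lia | by rewrite UN negbK]].
move=> d dB dE; exists d; split=> //.
- by move=> a b c ab bc Ub; rewrite !dE; apply: JU.
- by move=> a c; rewrite dE => /JP[ac]; apply; [left | left |].
- move=> z zB zA zx a c iz; rewrite dE; apply/JP; split; first exact: inverted_lt iz.
  move=> a' c' ha hc lac; apply: zx.
  have iac' : inverted z a' c.
    case: ha => [->//|[l u]]; apply: zA iz => //.
    by case: hc => [<-//|[]]; lia.
  by case: hc => [->//|[l u]]; apply: avoid_right iac'.
- move=> a c ac; rewrite dE /J ac /= => /forallPn[a' /forallPn[c']].
  rewrite negb_imply => /andP[/and3P[ha hc lac] ni]; exists a', c'; split=> //.
    by case/orP: ha => [/eqP|/andP]; [left | right].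
  by case/orP: hc => [/eqP|/andP]; [left | right].
Qed.

(** [x] and [y] lie below the largest avoiding element under [j], hence so does [j]. *)
Lemma avoid_join x y j : x \in Bn n -> y \in Bn n -> avoid x -> avoid y ->
  is_join x y j -> avoid j.
Proof.
move=> xB yB xA yA /is_joinP[] // jB xj yj jmin.
have [d [dB dA dj dmax _]] := largest_avoid jB.
suff -> : j = d by [].
by apply: le_anti => //; apply: jmin => //; apply: dmax.
Qed.

Definition same_avoid x y := [/\ x \in Bn n, y \in Bn n &
  forall z, z \in Bn n -> avoid z -> le z x <-> le z y].

Lemma same_avoid_meet x y z m m' : z \in Bn n -> same_avoid x y ->
  is_meet x z m -> is_meet y z m' -> same_avoid m m'.
Proof.
move=> zB [xB yB h] /is_meetP[] // mB mx mz mmax /is_meetP[] // mB' my' mz' mmax'.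
split=> // t tB tA; split=> tm.
  apply: mmax' => //; last by move=> a b /tm/mz.
  by apply/h => // a b /tm/mx.
apply: mmax => //; last by move=> a b /tm/mz'.
by apply/h => // a b /tm/my'.
Qed.

End Avoid.

(** * Self-duality of having the same avoiding elements below *)

Section Duality.
Variables (n : nat).
Implicit Types (u v a b c d : pmn n) (w x y z : {perm pmn n}) (U : pred (pmn n)).

(** The largest avoiding element below [y'] is also below [x'], so it misses [(a, c)];
    [largest_avoid] then gives a consequence missing from [y'], against cotransitivity. *)
Lemma same_avoid_opp U x y : (forall u, U (negpm u) = ~~ U u) ->
  same_avoid U x y -> same_avoid (predC U) (opp x) (opp y).
Proof.
move=> UN; have UN' u : predC U (negpm u) = ~~ predC U u by rewrite /= UN.
have main x' y' z : same_avoid U x' y' -> z \in Bn n -> avoid (predC U) z ->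
    le z (opp x') -> le z (opp y').
  move=> [xB yB hxy] zB zA zx a c; rewrite inverted_opp => iz.
  (* A pair (a, c) with c - a minimal, inverted in both z and y', yields a smaller one. *)
  rewrite (inverted_lt iz) /=; have [k] := ubnP (V c - V a).
  elim: k a c iz => // k IHk a c iz lk; apply/negP => iy.
  have zB' := avoid_right UN' zB zA; rewrite /= in zB'.
  have [d [dB dA dy dmax dN]] := largest_avoid UN yB.
  have nd : ~~ inverted d a c.
    have := zx _ _ iz; rewrite inverted_opp => /andP[_]; apply: contra.
    by apply: (hxy d dB dA).2.
  have ac := inverted_lt iz.
  have [a' [c' [ha hc lac ni]]] := dN a c ac nd.
  have KU b : V a < V b -> V b < V c -> U b -> ~~ inverted y' a b.
    move=> ab bc Ub; apply: (IHk a b); last by clear -ab bc lk; lia.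
    by apply: (zB' a b c) => //; rewrite negbK.
  have KL b : V a < V b -> V b < V c -> ~~ U b -> ~~ inverted y' b c.
    by move=> ab bc Ub; apply: (IHk b c); [apply: (zA a b c) | clear -ab bc lk; lia].
  have co := @inverted_cotrans n y'.
  case: ha lac ni => [->|[la Ua]]; case: hc => [->|[lc Uc]] lac ni; first by rewrite iy in ni.
  - by case/orP: (co _ _ _ lac lc iy); apply/negP => //; apply: KL.
  - by case/orP: (co _ _ _ la lac iy); apply/negP => //; apply: KU.
  have ac' := ltn_trans la lac; have a'c := ltn_trans lac lc.
  case/orP: (co _ _ _ la a'c iy); first by apply/negP/KU.
  by case/(co _ _ _ lac lc)/orP; apply/negP => //; apply: KL.
move=> [xB yB h]; split; rewrite ?opp_Bn // => z zB zA; split; apply: main => //.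
by split=> // t tB tA; rewrite h.
Qed.
End Duality.

(** * The generating pairs and the value colouring *)

(** The two-letter word at an edge of label 3: a three-cycle around [B] and its mirror image. *)
Lemma mirror_swap_comp n B p : 0 < B -> B < (n + n).-1 ->
  B <> n -> B + 1 <> n -> p < n + n ->
  mirror_swap (n + n) B (mirror_swap (n + n) (B - 1) p) =
 if p + 1 == B then B + 1 else if p == B then B - 1 else if p == B + 1 then B
 else if p + B == n + n then p - 2
  else if p + B + 1 == n + n then p + 1 else if p + B + 2 == n + n then p + 1 else p.
Proof.
move=> h1 h2 h3 h4 hp.
case: eqP => [?|?]; first by rewrite (@mirror_swap1 _ (B - 1)) ?(@mirror_swap1 _ B); lia.
case: eqP => [?|?]; first by rewrite (@mirror_swap2 _ (B - 1)) ?(@mirror_swap5 _ B); lia.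
case: eqP => [?|?]; first by rewrite (@mirror_swap5 _ (B - 1)) ?(@mirror_swap2 _ B); lia.
case: eqP => [?|?]; first by rewrite (@mirror_swap4 _ (B - 1)) ?(@mirror_swap4 _ B); lia.
case: eqP => [?|?]; first by rewrite (@mirror_swap3 _ (B - 1)) ?(@mirror_swap5 _ B); lia.
case: eqP => [?|?]; first by rewrite (@mirror_swap5 _ (B - 1)) ?(@mirror_swap3 _ B); lia.
by rewrite (@mirror_swap5 _ (B - 1)) ?(@mirror_swap5 _ B); lia.
Qed.

(** The three-letter word at the edge of label 4, with [B] the index of 1 or -1; only -2, -1, 1, 2
    move. *)
Lemma mirror_swap_alt n B p : 0 < B -> B < (n + n).-1 -> B = n \/ B + 1 = n -> p < n + n ->
 mirror_swap (n + n) (B - 1) (mirror_swap (n + n) B (mirror_swap (n + n) (B - 1) p)) =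
 if (p + 2 == n) then (if B == n then n else n + 1) else
 if (p + 1 == n) then (if B == n then n + 1 else n - 1) else
 if (p == n) then (if B == n then n - 2 else n) else 
 if (p == n + 1) then (if B == n then n - 1 else n - 2) else p.
Proof.
move=> h1 h2 h3 hp.
case: (eqVneq B n) => [eB|nB].
  clear h3; move: hp h1 h2; rewrite -{}eB {n} => hp h1 h2.
  case: eqP => [e|?]; first by rewrite (@mirror_swap5 _ _ p) ?(@mirror_swap3 _ B) ?mirror_swap1; lia.
  case: eqP => [e|?]; first by rewrite (@mirror_swap1 _ _ p) ?(@mirror_swap1 _ B) ?mirror_swap5; lia.
  case: eqP => [e|?]; first by rewrite (@mirror_swap2 _ _ p) ?(@mirror_swap4 _ B) ?mirror_swap5; lia.
  case: eqP => [e|?]; first by rewrite (@mirror_swap5 _ _ p) ?(@mirror_swap2 _ B) ?mirror_swap2; lia.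
  by rewrite !mirror_swap5; lia.
have {nB h3} eB : n = B + 1 by lia.
move: h2; rewrite {}eB {n hp} => h2.
case: eqP => [e|?]; first by rewrite (@mirror_swap1 _ _ p) ?(@mirror_swap1 _ B) ?mirror_swap3; lia.
case: eqP => [e|?]; first by rewrite (@mirror_swap2 _ _ p) ?(@mirror_swap5 _ B) ?mirror_swap1; lia.
case: eqP => [e|?]; first by rewrite (@mirror_swap3 _ _ p) ?(@mirror_swap5 _ B) ?mirror_swap4; lia.
case: eqP => [e|?]; first by rewrite (@mirror_swap4 _ _ p) ?(@mirror_swap2 _ B) ?mirror_swap2; lia.
by rewrite !mirror_swap5; lia.
Qed.

Section Generators.
Variables (n : nat) (D : rel 'I_n).
Hypothesis Dor : orientation D.
Implicit Types (u v a b c d : pmn n) (w x y z : {perm pmn n}).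

(** A positive value with index [j] is upper when the edge joining generators [j + 1] and [j] points
    to [j]. The largest value has no such edge and is not upper by default, so [upper_neg] has no
    exception. *)
Definition upper (u : pmn n) : bool :=
  u.1 (+) [exists i : 'I_n, (val i == u.2.+1) && D i u.2].

Lemma upper_neg u : upper (negpm u) = ~~ upper u.
Proof. by rewrite /upper /= addNb. Qed.

(* [b] or [negpm b] is the value moved by both [gen s] and [gen t]; the sign is
   chosen so that an edge [s -> t] makes [b] upper. *)
Definition edge_value (b : pmn n) (s t : 'I_n) : Prop :=
  (val s = (val t).+1 /\ b = (false, t)) \/ (val t = (val s).+1 /\ b = (true, s)).

Lemma edge_upper s t : D s t -> exists2 b, edge_value b s t & upper b.
Proof.
case: Dor => D1 D2 Dst; have := D1 s t Dst; rewrite /cox_edge => /orP[] /eqP e.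
  exists (true, s); first by right; split.
  rewrite /upper /= ; apply/existsP => -[i /andP[/eqP ei Dis]].
  have ei' : i = t by apply: val_inj; rewrite /= ei -e.
  by move: (D2 _ _ (D1 s t Dst)); rewrite Dst -{1}ei' Dis -ei' Dis.
exists (false, t); first by left; split.
by rewrite /upper /=; apply/existsP; exists s; rewrite Dst andbT -e.
Qed.

Lemma upper_edge b : upper b -> 0 < V b -> V b < (n + n).-1 ->
  exists s t, edge_value b s t /\ D s t.
Proof.
case: Dor => D1 D2; case: b => -[] j; rewrite /upper /V /= => hU h1 h2.
  have hj : j.+1 < n by lia.
  pose t := Ordinal hj; exists j, t; split; first by right.
  have /D2 : cox_edge j t by rewrite /cox_edge /= eqxx.
  case/orP => /andP[] // Dtj _; move/existsPn/(_ t): hU.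
  by rewrite Dtj /= eqxx.
by case/existsP: hU => i /andP[/eqP e Dij]; exists i, j; split=> //; left.
Qed.

(** Whatever the sign of [b], [gen t] exchanges its index with the previous one and [gen s] with the
    next one. *)
Lemma V_edge b s t u : edge_value b s t ->
  [/\ 0 < V b, V b < (n + n).-1, V (gen t u) = mirror_swap (n + n) (V b - 1) (V u) &
      V (gen s u) = mirror_swap (n + n) (V b) (V u)].
Proof.
have hs := ltn_ord s; have ht := ltn_ord t.
rewrite !V_gen; move: (V u) => p.
case=> -[/= e ->]; rewrite /V /= e; split; try lia.
- by congr (mirror_swap _ _ p); lia.
- by apply: mirror_swapC; lia.
- by apply: mirror_swapC; lia.
Qed.

Lemma cox_edge_value b s t : edge_value b s t ->
  cox_m s t = if (V b == n) || (V b + 1 == n) then 4 else 3.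
Proof.
have hs := ltn_ord s; have ht := ltn_ord t.
case=> -[/= e ->]; rewrite /V /cox_m /cox_edge /= e eqxx ?orbT /=.
  by case: ifP; case: ifP => //; lia.
by case: ifP; case: ifP => //; lia.
Qed.

Definition alt_elem (s t : 'I_n) := alt_word (gen t) (gen s) (cox_m s t).-1.

Lemma V_alt_elem b s t u : edge_value b s t -> V (alt_elem s t u) =
  let B := V b in let p := V u in
  let f := mirror_swap (n + n) in
  if (B == n) || (B + 1 == n) then f (B - 1) (f B (f (B - 1) p)) else f B (f (B - 1) p).
Proof.
move=> e; have h v := V_edge v e.
rewrite /alt_elem /alt_word (cox_edge_value e) /=.
case: ifP => _ /=; rewrite !big_ord_recl big_ord0 /= mulg1 !permM.
  by case: (h (gen s (gen t u))) => _ _ -> _; case: (h (gen t u)) => _ _ _ ->;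
     case: (h u) => _ _ -> _.
by case: (h (gen t u)) => _ _ _ ->; case: (h u) => _ _ -> _.
Qed.

Lemma inverted_gen b s t u v : edge_value b s t -> inverted (gen t) u v =
  (V u + 1 == V b) && (V v == V b) || (V u + V b + 1 == n + n) && (V v + V b == n + n).
Proof.
move=> e; have [h1 h2 eu _] := V_edge u e; have [_ _ ev _] := V_edge v e.
have lu := V_lt u; have lv := V_lt v.
rewrite /inverted eu ev; case: (ltngtP (V u) (V v)) => luv /=.
- move: (V u) (V v) (V b) lu lv h1 h2 luv => p q B lu lv h1 h2 luv.
  have sw k : k < n + n -> mirror_swap (n + n) (B - 1) k =
    if k + 1 == B then B else if k == B then B - 1
    else if k + B + 1 == n + n then k + 1 else if k + B == n + n then k - 1 else k.
  move=> hx; case: eqP => ?; first by rewrite mirror_swap1; lia.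
  case: eqP => ?; first by rewrite mirror_swap2; lia.
  case: eqP => ?; first by rewrite mirror_swap3; lia.
  by case: eqP => ?; [rewrite mirror_swap4 | rewrite mirror_swap5]; lia.
by rewrite !sw // {sw e eu ev}; repeat (case: eqP => ? //=); lia.
- by clear -h1 h2 luv; lia.
- by clear -h1 h2 luv; lia.
Qed.

(** The inverted pairs of the alternating word: [(B - 1, B)], [(B - 1, B + 1)], their mirror images
    and, for label 4, the pair of -2 and 2. *)
Definition alt_pairs (B p q : nat) : bool :=
  [|| (p + 1 == B) && (q == B), (p + B + 1 == n + n) && (q + B == n + n),
      (p + 1 == B) && (q == B + 1), (p + B + 2 == n + n) && (q + B == n + n)
    | ((B == n) || (B + 1 == n)) && (p + 2 == n) && (q == n + 1)].

Lemma inverted_alt b s t u v : edge_value b s t ->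
  inverted (alt_elem s t) u v = alt_pairs (V b) (V u) (V v).
Proof.
move=> e; have [h1 h2 _ _] := V_edge u e.
have lu := V_lt u; have lv := V_lt v.
rewrite /inverted !(V_alt_elem _ e) /=.
move: (V u) (V v) (V b) lu lv h1 h2 => p q B lu lv h1 h2; rewrite /alt_pairs {e}.
case: ifP => [/orP hB|/norP[/eqP hB /eqP hB']].
  have {}hB : B = n \/ B + 1 = n by case: hB => /eqP; [left|right].
  rewrite !mirror_swap_alt //.
  by case: hB => hB; move: lu lv h1 h2; rewrite -{}hB; rewrite ?eqxx;
     repeat (case: eqP => ? //=); lia.
rewrite !mirror_swap_comp //.
repeat (case: eqP => ? //=); lia.
Qed.

Lemma gen_le_alt b s t : edge_value b s t -> le (gen t) (alt_elem s t).
Proof.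
move=> e u v; rewrite (inverted_gen _ _ e) (inverted_alt _ _ e) /alt_pairs.
by case/orP => ->; rewrite ?orbT.
Qed.

Lemma alt_elem_Bn s t : alt_elem s t \in Bn n.
Proof.
rewrite /alt_elem /alt_word; elim/big_ind: _ => [|x y|i _]; [exact: Bn1 | exact: BnM |].
by case: ifP => _; apply: gen_Bn.
Qed.

(** A pair inverted by the alternating word but not by [gen t] jumps over [b], up to mirror image.
    Avoidance would add an inversion starting at [b], which leads outside [alt_pairs]. *)
Lemma same_avoid_gen s t : D s t -> same_avoid upper (gen t) (alt_elem s t).
Proof.
move=> Dst; have [b e Ub] := edge_upper Dst; split; rewrite ?gen_Bn ?alt_elem_Bn //.
move=> z zB zA; split=> [h u v /h|h u v iz]; first exact: gen_le_alt e _ _.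
rewrite (inverted_gen _ _ e); have [h1 h2 _ _] := V_edge b e.
have hz c d : inverted z c d -> alt_pairs (V b) (V c) (V d).
  by move=> /h; rewrite (inverted_alt _ _ e).
have N1 c d : inverted z c d -> V c + 1 = V b -> V d = V b + 1 -> False.
  move=> i ex ey; have /hz : inverted z b d by apply: zA i => //; lia.
  by rewrite /alt_pairs; clear -h1 h2 ey; lia.
have N2 c d : inverted z c d -> V c + V b + 2 = n + n -> V d + V b = n + n -> False.
  rewrite -inverted_neg // => /N1 h' ex ey; apply: h'.
    by have := V_neg d; lia.
  by have := V_neg c; lia.
have N3 c d : inverted z c d -> V c + 2 = n -> V d = n + 1 -> V b = n \/ V b + 1 = n -> False.
  move=> i ex ey hb; have ib : inverted z b d by apply: zA i => //; lia.
  have := hz _ _ ib; case: hb => hb; first by rewrite /alt_pairs; clear -h1 h2 ey hb; lia.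
  by move=> _; apply: N2 ib _ _; lia.
have := hz _ _ iz; have := N1 _ _ iz; have := N2 _ _ iz; have := N3 _ _ iz.
by rewrite /alt_pairs; clear; lia.
Qed.

Lemma same_avoid_congruence : lattice_congruence (same_avoid upper).
Proof.
have UN := upper_neg; have UN' u : predC upper (negpm u) = ~~ predC upper u by rewrite /= UN.
split; first by move=> x y [].
split.
- by move=> x xB; split.
- by move=> x y [xB yB h]; split=> // z zB zA; rewrite h.
- by move=> x y z [xB yB h] [_ zB h']; split=> // t tB tA; rewrite h ?h'.
- by move=> x y z m m' zB; apply: same_avoid_meet.
move=> x y z j j' zB xy hj hj'; have [xB yB _] := xy.
(* Joins are meets after reversal with exchanged colours; a second reversal restores both. *)
have := same_avoid_meet (opp_Bn zB) (same_avoid_opp UN xy)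
  (is_join_opp xB zB hj) (is_join_opp yB zB hj').
move/(same_avoid_opp UN'); rewrite !oppK => -[jB j'B h]; split=> // t tB tA.
by apply: h => // a b c ab bc Ub; apply: tA; rewrite //= negbK in Ub *.
Qed.

(** [Theta] is contained in [same_avoid], so an avoiding [x], being below itself, is below its whole
    class. *)
Lemma avoid_theta_min x : x \in Bn n -> avoid upper x -> theta_min D x.
Proof.
move=> xB xA; split=> // y yB yx lyx.
have [_ _ h] : same_avoid upper y x.
  by apply: yx; [exact: same_avoid_congruence | exact: same_avoid_gen].
apply: le_anti; first exact/weak_le_iff.
by apply/(h x xB xA).
Qed.

End Generators.

(** * Exchanging consecutive entries *)

Definition pair_swap (P Q P' Q' r : nat) :=
  if r == P then Q else if r == Q then P
  else if r == P' then Q' else if r == Q' then P' else r.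
Lemma pair_swap_lt n P Q P' Q' r s : Q < P -> P' + P + 1 = n + n -> Q' + Q + 1 = n + n ->
  (forall k, k \in [:: P'; Q'; r; s] -> k <= Q \/ P <= k) ->
  (forall k, k \in [:: r; s] -> k <= P' \/ Q' <= k) ->
  ~~ ((r == Q) && (s == P)) -> ~~ ((r == P') && (s == Q')) ->
  r < s -> pair_swap P Q P' Q' r < pair_swap P Q P' Q' s.
Proof.
move=> lt eP eQ A B.
(* The intervals [[Q, P]] and [[P', Q']] are mirror images without interior positions in play, and
   no position is its own mirror image: they are disjoint or equal. *)
have tri : [\/ Q' < Q, Q' = P /\ P' = Q | P < P'].
  have [] := A P'; rewrite ?inE ?eqxx ?orbT // => h;
    have [] := A Q'; rewrite ?inE ?eqxx ?orbT // => h'.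
  - have [?|?] := eqVneq P' Q; first by constructor 2; lia.
    by constructor 1; lia.
  - by constructor 2; lia.
  - by lia.
  - have [?|?] := eqVneq Q' P; first by constructor 2; lia.
    by constructor 3; lia.
have := A r; have := A s; have := B r; have := B s; rewrite !inE !eqxx !orbT /=.
move=> /(_ isT) Bs /(_ isT) Br /(_ isT) As /(_ isT) Ar; rewrite /pair_swap.
clear A B.
case: (r =P P) => [?|?]; first by case: tri => [?|[? ?]|?]; repeat (case: eqP => ?); lia.
case: (r =P Q) => [?|?]; first by case: tri => [?|[? ?]|?]; repeat (case: eqP => ?); lia.
case: (r =P P') => [?|?]; first by case: tri => [?|[? ?]|?]; repeat (case: eqP => ?); lia.
case: (r =P Q') => [?|?]; first by case: tri => [?|[? ?]|?]; repeat (case: eqP => ?); lia.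
case: tri => [?|[? ?]|?]; repeat (case: eqP => ?); lia.
Qed.

Section Swap.
Variable n : nat.
Implicit Types (u v a b c d : pmn n) (w x y z : {perm pmn n}).

Definition adjacent x a c :=
  V (x c) < V (x a) /\ forall v, V (x v) <= V (x c) \/ V (x a) <= V (x v).

Definition swap x a c : {perm pmn n} := tref a c * x.

Lemma swap_Bn x a c : x \in Bn n -> swap x a c \in Bn n.
Proof. by move=> xB; rewrite BnM ?tref_Bn. Qed.

Lemma swapE x a c u : swap x a c u = x (tref a c u).
Proof. by rewrite permM. Qed.

Lemma V_perm_eq x u v : (u == v) = (V (x u) == V (x v)).
Proof. by rewrite -V_eq (inj_eq perm_inj). Qed.

Lemma V_swap x a c u : V (swap x a c u) =
  pair_swap (V (x a)) (V (x c)) (V (x (negpm a))) (V (x (negpm c))) (V (x u)).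
Proof.
rewrite swapE trefE !(V_perm_eq x) /pair_swap.
by do 4 (case: eqP => // _).
Qed.

Lemma swap_lt x a c u v : x \in Bn n -> adjacent x a c ->
  ~~ ((u == c) && (v == a)) -> ~~ ((u == negpm a) && (v == negpm c)) ->
  V (x u) < V (x v) -> V (swap x a c u) < V (swap x a c v).
Proof.
move=> xB [lt adj]; rewrite !(V_perm_eq x) !V_swap => h1 h2 luv.
have ha := V_Bn a xB; have hc := V_Bn c xB.
apply: (@pair_swap_lt n) => //; rewrite -1?[V (x a) + _]addnC; try lia.
  by move=> k; rewrite !inE => /or4P[]/eqP->; apply: adj.
move=> k; rewrite !inE => /orP[]/eqP->.
  by have := adj (negpm u); have := V_Bn u xB; lia.
by have := adj (negpm v); have := V_Bn v xB; lia.
Qed.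

(** Only one pair and its mirror image are lost, so the exchange is a lower cover of [x]. *)
Lemma inverted_swap x a c u v : x \in Bn n -> V a < V c -> adjacent x a c ->
  inverted (swap x a c) u v =
  [&& inverted x u v, ~~ ((u == a) && (v == c)) & ~~ ((u == negpm c) && (v == negpm a))].
Proof.
move=> xB ac adj.
have hac : V (negpm c) < V (negpm a) by have := V_neg a; have := V_neg c; lia.
rewrite /inverted; case luv: (V u < V v) => //=.
case e1: ((u == a) && (v == c)).
  case/andP: e1 => /eqP-> /eqP->; rewrite andbF !swapE !trefE !eqxx.
  by case: eqP => [->|_]; case: adj; lia.
case e2: ((u == negpm c) && (v == negpm a)).
  case/andP: e2 => /eqP-> /eqP->; rewrite !andbF -/(negpm _).
  have := V_Bn a (swap_Bn a c xB); have := V_Bn c (swap_Bn a c xB).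
  rewrite !swapE !trefE !eqxx; case: (eqVneq c a) => [->|_]; first by lia.
  by case: adj; lia.
rewrite andbT; apply/idP/idP => h; last first.
  by apply: swap_lt => //; rewrite andbC ?e1 ?e2.
rewrite ltnNge leq_eqVlt negb_or -(V_perm_eq x) V_eq; apply/andP; split; first lia.
apply/negP => h'; have := @swap_lt x a c u v xB adj _ _ h'.
have [e3|_] := boolP ((u == c) && (v == a)).
  by case/andP: e3 => /eqP eu /eqP ev; move: luv ac; rewrite eu ev; lia.
have [e3|_] := boolP ((u == negpm a) && (v == negpm c)).
  by case/andP: e3 => /eqP eu /eqP ev; move: luv hac; rewrite eu ev; lia.
by move/(_ isT isT); lia.
Qed.

End Swap.

(** * Forcing *)

Section Forcing.
Variable n : nat.
Variable R : {perm pmn n} -> {perm pmn n} -> Prop.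
Hypothesis Rcong : lattice_congruence R.
Implicit Types (u v a b c d : pmn n) (e f g w x y z : {perm pmn n}).

Lemma cong_Bn x y : R x y -> x \in Bn n /\ y \in Bn n.
Proof. by case: Rcong => h _; apply: h. Qed.

Lemma cong_join x y z j j' : z \in Bn n -> R x y ->
  j \in Bn n -> le x j -> le z j -> (forall t, le x t -> le z t -> le j t) ->
  j' \in Bn n -> le y j' -> le z j' -> (forall t, le y t -> le z t -> le j' t) ->
  R j j'.
Proof.
move=> zB xy jB xj zj jmin j'B yj zj' j'min; have [xB yB] := cong_Bn xy.
case: Rcong => _ [_ _ _ _ RJ]; apply: (RJ x y z j j' zB xy).
  by apply/(is_joinP j xB zB); split=> // t _; apply: jmin.
by apply/(is_joinP j' yB zB); split=> // t _; apply: j'min.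
Qed.

Lemma cong_meet x y z m m' : z \in Bn n -> R x y ->
  m \in Bn n -> le m x -> le m z -> (forall t, le t x -> le t z -> le t m) ->
  m' \in Bn n -> le m' y -> le m' z -> (forall t, le t y -> le t z -> le t m') ->
  R m m'.
Proof.
move=> zB xy mB mx mz mmax m'B my mz' m'max; have [xB yB] := cong_Bn xy.
case: Rcong => _ [_ _ _ RM _]; apply: (RM x y z m m' zB xy).
  by apply/(is_meetP m xB zB); split=> // t _; apply: mmax.
by apply/(is_meetP m' yB zB); split=> // t _; apply: m'max.
Qed.

(* The polynomial [t |-> (t /\ g) \/ y] sends [e] to [y] and [f] to [x]. *)
Lemma cong_poly e f g x y : g \in Bn n -> x \in Bn n -> y \in Bn n -> R e f ->
  le y x -> (forall k, k \in Bn n -> le k e -> le k g -> le k y) ->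
  (forall m, m \in Bn n -> le m f -> le m g -> (forall z, le z f -> le z g -> le z m) ->
     (forall a b, inverted m a b =
        (V a < V b) && ~~ connect (join_rel (opp f) (opp g)) a b) ->
     le m x /\ forall z, le m z -> le y z -> le x z) ->
  R y x.
Proof.
move=> gB xB yB ef yx he hf; have [eB fB] := cong_Bn ef.
have [k [kB ke kg kmax _]] := meet_exists eB gB.
have [m [mB mf mg mmax mE]] := meet_exists fB gB.
have [mx xmin] := hf m mB mf mg mmax mE.
have km : R k m by apply: (cong_meet gB ef).
by apply: (cong_join yB km) => //; apply: he.
Qed.

(** The pairs at which a path of values from [a] up to [c] can cross the gap of [x] between [c] and
    [a]; if [f] inverts them all, [(a, c)] stays in the meet of [f] and [x]. *)
Definition dominates x f a c := forall p q,
  V a <= V p -> V p < V q -> V q <= V c ->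
  V (x a) <= V (x p) -> V (x q) <= V (x c) -> inverted f p q.

(** Use [cong_poly] with [g = x]: the meet with [e] lacks [(a, c)], hence is below the exchange,
    while the meet with [f] has [(a, c)] and so joins with the exchange to [x]. *)
Lemma force_swap x e f a c : x \in Bn n -> V a < V c -> adjacent x a c ->
  R e f -> ~~ inverted e a c -> dominates x f a c -> R (swap x a c) x.
Proof.
move=> xB ac adj ef nec dom; have yB := swap_Bn a c xB.
have [eB fB] := cong_Bn ef.
have yE u v := inverted_swap u v xB ac adj.
apply: (cong_poly xB xB yB ef).
- by move=> u v; rewrite yE => /and3P[].
- move=> k kB ke kx u v iuv; rewrite yE kx //=; apply/andP; split.
    by apply: contra nec => /andP[/eqP<- /eqP<-]; apply: ke.
  apply: contra nec => /andP[/eqP eu /eqP ev]; apply: ke.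
  by rewrite -inverted_neg // -eu -ev.
move=> m mB mf mx mmax mE; split=> // z mz yz u v iuv.
have no_path p : forall u', V a <= V u' -> V (x a) <= V (x u') ->
    path (join_rel (opp f) (opp x)) u' p -> c = last u' p -> False.
  elim: p => [|v' p IHp] u' lau' xu' /=.
    by move=> _ e'; case: adj; move: xu'; rewrite -e'; lia.
  case/andP => uv' pv' e'.
  have lvc : V v' <= V c by apply: (@join_rel_le _ (opp f) (opp x)); apply/connectP; exists p.
  have luv' : V u' < V v' by case/orP: uv' => /inverted_lt.
  case: (adj.2 v') => [hv|hv]; last by apply: (IHp v') => //; lia.
  (* A step across the gap is inverted both in [f] and in [x], so it is in neither complement. *)
  have := dom u' v' lau' luv' lvc xu' hv.
  move: uv'; rewrite /join_rel !inverted_opp luv' /= => /orP[/negP//|/negP h _]; apply: h.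
  by rewrite /inverted luv'; case: adj; lia.
have iac : inverted m a c.
  by rewrite mE ac /=; apply/negP => /connectP[p pp e']; apply: (no_path p a).
have [euv|neuv] := boolP ((u == a) && (v == c)).
  by case/andP: euv => /eqP-> /eqP->; apply: mz.
have [euv|neuv'] := boolP ((u == negpm c) && (v == negpm a)).
  by case/andP: euv => /eqP-> /eqP->; apply: mz; rewrite inverted_neg.
by apply: yz; rewrite yE iuv neuv.
Qed.

(* In a hexagon, a contracted top edge contracts the side edge opposite to it. *)
Lemma hexagon x a d c : x \in Bn n -> V a < V d -> V d < V c ->
  adjacent x a d -> adjacent x d c ->
  a != negpm c -> a != negpm d -> d != negpm c ->
  R (swap x a d) x \/ R (swap x d c) x ->
  exists y, R y x /\ ~~ inverted y a c.
Proof.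
move=> xB ad dc Aad Adc nac nad ndc.
have ac := ltn_trans ad dc.
have la := V_neg a; have lc := V_neg c; have ld := V_neg d.
rewrite !V_eq in nac nad ndc.
have yB := swap_Bn a d xB; have gB := swap_Bn d c xB.
have yE u v := inverted_swap u v xB ad Aad.
have gE u v := inverted_swap u v xB dc Adc.
have yx : le (swap x a d) x by move=> u v; rewrite yE => /and3P[].
have gx : le (swap x d c) x by move=> u v; rewrite gE => /and3P[].
have nac' k : le k (swap x a d) -> le k (swap x d c) -> ~~ inverted k a c.
  move=> ky kg; apply/negP => /(inverted_cotrans ad dc)/orP[/ky|/kg].
    by rewrite yE !eqxx andbF.
  by rewrite gE !eqxx andbF.
have nac'' k : k \in Bn n -> le k (swap x a d) -> le k (swap x d c) ->
    ~~ inverted k (negpm c) (negpm a).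
  by move=> kB ky kg; rewrite inverted_neg // nac'.
case=> [yR|gR].
- have Aac : adjacent (swap x a d) a c.
    have [lt adj] := Adc; have e1 : swap x a d a = x d by rewrite swapE trefE eqxx.
    have e2 : swap x a d c = x c.
      by rewrite swapE trefE !V_eq; do 4 (case: eqP => [?|_]; first by lia).
    by split=> [|v]; rewrite e1 e2 // swapE; apply: adj.
  have hE u v := inverted_swap u v yB ac Aac.
  exists (swap (swap x a d) a c); split; last by rewrite hE !eqxx andbF.
  apply: (cong_poly gB xB (swap_Bn a c yB) yR).
  + by move=> u v; rewrite hE => /and3P[/yx].
  + move=> k kB ky kg u v iuv; rewrite hE (ky _ _ iuv) /=; apply/andP; split.
      by apply: contra (nac' k ky kg) => /andP[/eqP<- /eqP<-].
    by apply: contra (nac'' k kB ky kg) => /andP[/eqP<- /eqP<-].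
  move=> m mB mx mg mmax _; split=> // z mz hz u v iuv.
  have gm := mmax _ gx (fun _ _ h => h).
  have [euv|/negPf neuv] := boolP ((u == d) && (v == c)).
    case/andP: euv iuv => /eqP-> /eqP-> iuv; apply: hz; rewrite hE yE iuv !V_eq; lia.
  have [euv|neuv'] := boolP ((u == negpm c) && (v == negpm d)).
    case/andP: euv iuv => /eqP-> /eqP-> iuv; apply: hz; rewrite hE yE iuv !V_eq; lia.
  by apply/mz/gm; rewrite gE iuv neuv.
have Aac : adjacent (swap x d c) a c.
  have [lt adj] := Aad; have e1 : swap x d c c = x d.
    by rewrite swapE trefE !V_eq; case: eqP => [?|_]; [lia | rewrite eqxx].
  have e2 : swap x d c a = x a.
    by rewrite swapE trefE !V_eq; do 4 (case: eqP => [?|_]; first by lia).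
  by split=> [|v]; rewrite e1 e2 // swapE; apply: adj.
have hE u v := inverted_swap u v gB ac Aac.
exists (swap (swap x d c) a c); split; last by rewrite hE !eqxx andbF.
apply: (cong_poly yB xB (swap_Bn a c gB) gR).
+ by move=> u v; rewrite hE => /and3P[/gx].
+ move=> k kB kg ky u v iuv; rewrite hE (kg _ _ iuv) /=; apply/andP; split.
    by apply: contra (nac' k ky kg) => /andP[/eqP<- /eqP<-].
  by apply: contra (nac'' k kB ky kg) => /andP[/eqP<- /eqP<-].
move=> m mB mx my mmax _; split=> // z mz hz u v iuv.
have ym := mmax _ yx (fun _ _ h => h).
have [euv|/negPf neuv] := boolP ((u == a) && (v == d)).
  case/andP: euv iuv => /eqP-> /eqP-> iuv; apply: hz; rewrite hE gE iuv !V_eq; lia.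
have [euv|neuv'] := boolP ((u == negpm d) && (v == negpm a)).
  case/andP: euv iuv => /eqP-> /eqP-> iuv; apply: hz; rewrite hE gE iuv !V_eq; lia.
by apply/mz/ym; rewrite yE iuv neuv.
Qed.

End Forcing.

(** * Moving an entry next to another one *)

Section Move.
Variable n : nat.
Implicit Types (u v a b c d : pmn n) (e f g w x y z : {perm pmn n}).

(* Moves [d] just after [c], and [negpm d] just before [negpm c]. *)
Definition move_key x c d v : nat :=
  (if v == d then 4 * V (x c) + 4 else
   if v == negpm d then 4 * V (x (negpm c)) else 4 * V (x v) + 2)%N.

(** Keys [4p + 2] leave the multiples of 4 as free slots between neighbours; with [c] in the right
    half, the slots of [d] and [negpm d] differ. *)
Lemma move_exists x c d : x \in Bn n -> n <= V (x c) -> c != d -> c != negpm d ->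
  exists2 y, y \in Bn n &
    forall u v, (V (y u) < V (y v)) = (move_key x c d u < move_key x c d v).
Proof.
move=> xB nc cd cnd; have hc := V_Bn c xB; have ld := V_neg d.
apply: key_perm.
  move=> u v; rewrite /move_key.
  have [->|nu] := eqVneq u d; have [->|nv] := eqVneq v d => //.
  - by have [->|_] := eqVneq v (negpm d); lia.
  - by have [->|_] := eqVneq u (negpm d); lia.
  have [->|nu'] := eqVneq u (negpm d); have [->|nv'] := eqVneq v (negpm d) => //; try lia.
  by move=> h; apply: (@perm_inj _ x); apply: V_inj; lia.
move=> u v; rewrite /move_key !(inv_eq (@negpmK n)) negpmK.
have hu := V_Bn u xB; have hv := V_Bn v xB.
have [->|nu] := eqVneq u d; have [->|nv] := eqVneq v d; rewrite ?V_eq; repeat case: eqP; lia.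
Qed.
End Move.

(** * Contracting an exchange that jumps over an upper value *)

Section ForceSwap.
Variables (n : nat) (D : rel 'I_n) (R : {perm pmn n} -> {perm pmn n} -> Prop).
Hypotheses (Dor : orientation D) (Rcong : lattice_congruence R).
Hypothesis Rgen : forall s t, D s t -> R (gen t) (alt_elem s t).
Implicit Types (u v a b c d : pmn n) (e f g w x y z : {perm pmn n}).

(** With [d] moved between [c] and [a], the three entries are at the top of a hexagon. It yields an
    element congruent to [y] without [(a, c)], and [y] still dominates, so [force_swap] applies to
    [x]. *)
Lemma move_force x a c d : x \in Bn n -> V a < V d -> V d < V c -> adjacent x a c ->
  n <= V (x c) -> a != negpm d -> d != negpm c ->
  (V a < V (negpm d) -> V (negpm d) < V c -> V (x (negpm d)) < V (x a)) ->
  (forall y, y \in Bn n ->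
     (forall u v, (V (y u) < V (y v)) = (move_key x c d u < move_key x c d v)) ->
     adjacent y a d -> adjacent y d c -> R (swap y a d) y \/ R (swap y d c) y) ->
  R (swap x a c) x.
Proof.
move=> xB ad dc adj hc nad ndc hd H; have ac := ltn_trans ad dc.
have la := V_neg a; have lc := V_neg c; have ld := V_neg d.
have [lt gap] := adj; have lxa := V_lt (x a).
have hxa := V_Bn a xB; have hxc := V_Bn c xB; have hxd := V_Bn d xB.
have cd : c != d by rewrite V_eq; lia.
have cnd : c != negpm d by rewrite V_eq; rewrite V_eq in ndc; lia.
have nac : a != negpm c.
  by apply: contraTneq lt => e; move: hxc; rewrite -e; lia.
have [y yB yE] := move_exists xB hc cd cnd.
have kc : move_key x c d c = (4 * V (x c) + 2)%N by rewrite /move_key (negPf cd) (negPf cnd).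
have ka : move_key x c d a = (4 * V (x a) + 2)%N.
  by rewrite /move_key (negPf nad); case: eqP => // e; move: ad; rewrite e ltnn.
have kd : move_key x c d d = (4 * V (x c) + 4)%N by rewrite /move_key eqxx.
have knd : move_key x c d (negpm d) = (4 * V (x (negpm c)))%N.
  by rewrite /move_key negpm_neq eqxx.
have ko v : v != d -> v != negpm d -> move_key x c d v = (4 * V (x v) + 2)%N.
  by rewrite /move_key => /negPf-> /negPf->.
have Aad : adjacent y a d.
  split=> [|v]; first by rewrite yE ka kd; lia.
  have := yE d v; have := yE v a; rewrite ka kd.
  have [->|nd] := eqVneq v d; first by rewrite kd; clear -lt; lia.
  have [->|nnd] := eqVneq v (negpm d); first by rewrite knd; clear -hxc hc lt; lia.
  by rewrite ko //; have := gap v; clear; lia.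
have Adc : adjacent y d c.
  split=> [|v]; first by rewrite yE kc kd; lia.
  have := yE c v; have := yE v d; rewrite kc kd.
  have [->|nd] := eqVneq v d; first by rewrite kd; clear -lt; lia.
  have [->|nnd] := eqVneq v (negpm d); first by rewrite knd; clear -hxc hc lt; lia.
  by rewrite ko //; have := gap v; clear; lia.
have [z [zR nz]] := hexagon Rcong yB ad dc Aad Adc nac nad ndc (H y yB yE Aad Adc).
apply: (force_swap Rcong xB ac adj zR nz) => p q lap lpq lqc hp hq.
rewrite /inverted lpq yE /=.
have [ep|np] := eqVneq p d.
  rewrite ep kd; have nqd : q != d by rewrite V_eq -ep; clear -lpq; lia.
  have [->|nq] := eqVneq q (negpm d); first by rewrite knd; clear -hxc hc; lia.
  by rewrite ko //; clear -hq; lia.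
have [ep|np'] := eqVneq p (negpm d).
  (* [negpm d] has moved left, but [hd] keeps it from being the later entry of such a pair. *)
  exfalso; have : V a != V (negpm d) by rewrite -V_eq.
  by move: lap lpq lqc hp hd; rewrite ep; clear; lia.
rewrite (ko p) //; have [->|nq] := eqVneq q d; first by rewrite kd; clear -hp lt; lia.
have [->|nq'] := eqVneq q (negpm d); first by rewrite knd; clear -hp hxc hc lt; lia.
by rewrite ko //; clear -hp hq lt; lia.
Qed.

(* No pair [(a, c)] with [a < b < c] and [V b = B] is cut; joining the element of the
   generating pair at [b] adds all of them except those ending in [negpm b]. *)
Definition cut (B : nat) (u v : pmn n) : bool :=
  [&& V u < V v, (V v <= B) || (B < V u) & (V v + B + 1 < n + n) || (n + n <= V u + B + 1)].

Lemma cut_exists B : exists2 w, w \in Bn n & inverted w =2 cut B.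
Proof.
apply: biclosed_inv; rewrite /cut.
- by move=> a b /and3P[].
- by move=> b a c; lia.
- by move=> a b c; lia.
- by move=> a b; have := V_neg a; have := V_neg b; lia.
Qed.

Lemma cut_join B w : w \in Bn n -> 0 < B -> B < (n + n).-1 ->
  (forall u v, cut B u v -> inverted w u v) ->
  (forall u v, alt_pairs n B (V u) (V v) -> inverted w u v) ->
  forall u v, V u < V v -> (V u <> B \/ B + 1 = n) -> (V v + B + 1 <> n + n \/ B + 1 = n) ->
    (V u <> B \/ V v + B + 1 <> n + n) ->
  inverted w u v.
Proof.
move=> wB B0 B1 hcut halt.
pose F p q := forall u v, V u = p -> V v = q -> inverted w u v.
have FT q p r : q < n + n -> F p q -> F q r -> F p r.
  move=> /V_surj[x ex] pq qr u v eu ev.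
  by apply: (@inverted_trans _ _ _ x); [apply: pq | apply: qr].
have FC p q : p < q -> (q <= B) || (B < p) ->
    (q + B + 1 < n + n) || (n + n <= p + B + 1) -> F p q.
  by move=> h1 h2 h3 u v eu ev; apply: hcut; rewrite /cut eu ev h1 h2 h3.
have FA : F (B - 1) (B + 1).
  by move=> u v eu ev; apply: halt; rewrite /alt_pairs eu ev; lia.
have FX : B = n \/ B + 1 = n -> F (n - 2) (n + 1).
  by move=> h u v eu ev; apply: halt; rewrite /alt_pairs eu ev; lia.
have FM p q : p < n + n -> q < n + n -> F (n + n - 1 - q) (n + n - 1 - p) -> F p q.
  move=> hp hq h u v eu ev; rewrite -inverted_neg //.
  by apply: h; [have := V_neg v | have := V_neg u]; lia.
(* Pairs across [b]. The values [b] and [negpm b] delimit three blocks inside which [hcut] inverts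
   everything; [halt] links the blocks. *)
have F1 p q : p < B -> B < q -> q < n + n -> q + B + 1 <> n + n -> F p q.
  move=> pB Bq qN nq.
  have [nB|Bn] := leqP n B.
    have FR r : B < r -> r < n + n -> F (B - 1) r.
      move=> Br rN; have [->//|?] := eqVneq r (B + 1).
      by apply: (FT (B + 1)) => //; [lia | apply: FC; lia].
    have FL r t : n + n <= r + B + 1 -> r < B -> B < t -> t < n + n -> F r t.
      move=> hr rB Bt tN; have [->|?] := eqVneq r (B - 1); first exact: FR.
      by apply: (FT (B - 1)); [lia | apply: FC; lia | apply: FR].
    have [?|?] := leqP (n + n) (p + B + 1); first exact: FL.
    (* If [b] is 1, the middle block is just -1, 1, and the pair of -2 and 2 links the outer
       blocks. *)
    have [eB|neB] := eqVneq B n; last first.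
      apply: (FT (B - 1)); [lia | | exact: FR].
      by apply: FM; [lia | lia | apply: FL; lia].
    have Fq : F (n - 2) q.
      have [->|?] := eqVneq q (n + 1); first by apply: FX; left.
      by apply: (FT (n + 1)); [lia | apply: FX; left | apply: FC; lia].
    have [->//|?] := eqVneq p (n - 2).
    by apply: (FT (n - 2)); [lia | apply: FC; lia |].
  have FL r t : r < B -> F (B - 1) t -> F r t.
    move=> rB h; have [->//|?] := eqVneq r (B - 1).
    by apply: (FT (B - 1)); [lia | apply: FC; lia |].
  have FR r t : r < B -> B < t -> t + B + 1 < n + n -> F r t.
    move=> rB Bt tB; apply: FL => //; have [->//|?] := eqVneq t (B + 1).
    by apply: (FT (B + 1)) => //; [lia | apply: FC; lia].
  have [?|?] := ltnP (q + B + 1) (n + n); first exact: FR.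
  have [eB|neB] := eqVneq (B + 1) n; last first.
    apply: (FT (B + 1)); [lia | apply: FR; lia |].
    by apply: FM; [lia | lia | apply: FR; lia].
  apply: FL => //; have -> : B - 1 = n - 2 by lia.
  have [->|?] := eqVneq q (n + 1); first by apply: FX; right.
  by apply: (FT (n + 1)); [lia | apply: FX; right | apply: FC; lia].
have F2 p q : p <= B -> B < q -> q < n + n -> (p <> B \/ B + 1 = n) ->
    (q + B + 1 <> n + n \/ B + 1 = n) -> (p <> B \/ q + B + 1 <> n + n) -> F p q.
  move=> pB Bq qN h1 h2 h3; have [ep|np] := eqVneq p B.
    have [eq|nq] := eqVneq q (n + 1).
      by move=> u v eu ev; apply: halt; rewrite /alt_pairs eu ev; lia.
    apply: (FT (n + 1)); [lia | | apply: FC; lia].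
    by move=> u v eu ev; apply: halt; rewrite /alt_pairs eu ev; lia.
  have [eq|nq] := eqVneq (q + B + 1) (n + n); last by apply: F1 => //; [lia | apply/eqP].
  have F0 : F (B - 1) q by have -> : q = B + 1 by lia.
  have [->//|?] := eqVneq p (B - 1).
  by apply: (FT (B - 1)); [lia | apply: FC; lia |].
move=> u v luv h1 h2 h3; have lv := V_lt v.
have [huv|huv] := boolP ((V u <= B) && (B < V v)).
  by case/andP: huv => *; apply: (F2 (V u) (V v)).
have [hcuv|hcuv] := boolP (cut B u v); first exact: hcut.
(* What remains crosses [negpm b] but not [b]; negation brings it back to [F2]. *)
have hm : V u + B + 1 < n + n /\ n + n <= V v + B + 1 by move: hcuv; rewrite /cut; lia.
by apply: (FM (V u) (V v)) => //; [lia | apply: F2; lia].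
Qed.

(* The last hypothesis keeps [negpm b] from being an entry of (a, c] to the left of [c]. *)
Lemma force_swap_direct x a b c : x \in Bn n -> V a < V b -> V b < V c -> adjacent x a c ->
  upper D b -> V (x b) < V (x c) ->
  (V b + 1 = n \/ (V a < V (negpm b) -> V (negpm b) <= V c -> V (x c) < V (x (negpm b)))) ->
  R (swap x a c) x.
Proof.
move=> xB ab bc adj Ub xbc hb; have lc := V_lt c; have lb := V_neg b.
have b0 : 0 < V b by clear -ab; lia.
have b1 : V b < (n + n).-1 by clear -bc lc; lia.
have [s [t [est Dst]]] := upper_edge Dor Ub b0 b1.
have [B0 B1 _ _] := V_edge b est.
have [w wB wE] := cut_exists (V b).
have [j [jB aj wj jmin _]] := join_exists (alt_elem_Bn s t) wB.
(* [gen t] is below [w], so joining the generating pair with [w] gives [w] and [j]. *)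
have gw : le (gen t) w.
  move=> u v; rewrite (inverted_gen _ _ est) wE /cut; have := V_lt v.
  by clear -B0 B1; lia.
have Rwj : R w j.
  by apply: (cong_join Rcong wB (Rgen Dst)) => // z _ wz.
apply: (force_swap Rcong xB (ltn_trans ab bc) adj Rwj).
  by rewrite wE /cut; clear -ab bc; lia.
move=> p q lap lpq lqc hp hq.
have pb : V p <> V b.
  by move=> /V_inj ep; move: hp; rewrite ep; case: adj => + _; clear -xbc; lia.
apply: (cut_join jB B0 B1) => //.
- by move=> u v h; apply: wj; rewrite wE.
- by move=> u v h; apply: aj; rewrite (inverted_alt _ _ est).
- by left.
- case: hb => [|hb]; [by right | left=> e].
  have eq : q = negpm b by apply: V_inj; clear -e lb; lia.
  move: lpq lqc hq; rewrite eq => lpq lqc hq.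
  by have := hb (leq_ltn_trans lap lpq) lqc; clear -hq; lia.
- by left.
Qed.

(** Unless [b] is -1, a value [d] strictly between [b] and [negpm b] is moved between the two
    entries; the edge [(a, d)] is then contracted directly, as [negpm b] exceeds [d]. *)
Lemma force_swap_mirror x a b : x \in Bn n -> V a < V b -> V b < V (negpm b) ->
  adjacent x a (negpm b) -> upper D b -> V (x b) < V (x (negpm b)) ->
  R (swap x a (negpm b)) x.
Proof.
move=> xB ab bc adj Ub xbc; have lb := V_neg b; have la := V_neg a.
have [eb|nb] := eqVneq (V b + 1) n.
  by apply: (@force_swap_direct x a b) => //; left.
have hxb := V_Bn b xB; have [lt gap] := adj; have hxa := V_Bn a xB.
have [r er] := @V_surj n (V b + 1) ltac:(clear -lb bc; lia).
have lr := V_neg r; have hxr := V_Bn r xB.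
suff H d : V d = V b + 1 \/ V d + V b + 2 = n + n -> V (x (negpm d)) < V (x a) ->
    R (swap x a (negpm b)) x.
  (* [a] stands in the right half, so [r] or [negpm r] stands before it; [d] is the negation of that
     one. *)
  have [h|h] := ltnP (V (x (negpm r))) (V (x a)); first by apply: (H r) => //; left.
  apply: (H (negpm r)); first by right; clear -er lr; lia.
  by rewrite negpmK; clear -h hxr hxb lt xbc; lia.
move=> hd hxd; have ld := V_neg d.
have bd : V b < V d by clear -hd lb bc nb; lia.
have db : V d < V (negpm b) by clear -hd lb bc nb; lia.
apply: (@move_force x a (negpm b) d) => //.
- exact: ltn_trans ab bd.
- by clear -hxb xbc; lia.
- by rewrite V_eq; clear -ld db lb ab; lia.
- by rewrite negpmK V_eq; clear -bd; lia.
move=> y yB yE Aad _; left; apply: (@force_swap_direct y a b) => //.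
  rewrite yE /move_key eqxx.
  case: eqP => [e|_]; first by move: bd; rewrite e ltnn.
  case: eqP => [e|_]; first by move: db; rewrite e negpmK ltnn.
  by clear -xbc; lia.
by right=> _; clear -db; lia.
Qed.

(** Interference means that [negpm b] is a value in [(a, c]] placed no later than [c]. Unless it is
    [c], it is moved between [c] and [a], and the sign of [b] decides which upper edge of the
    hexagon is contracted. *)
Lemma force_swap_upper x a b c : x \in Bn n -> V a < V b -> V b < V c -> adjacent x a c ->
  upper D b -> V (x b) < V (x c) -> R (swap x a c) x.
Proof.
move=> xB ab bc adj Ub xbc; have lb := V_neg b; have la := V_neg a; have lc := V_neg c.
have hxb := V_Bn b xB; have [lt gap] := adj.
have [h|] := boolP [&& V a < V (negpm b), V (negpm b) <= V c &
                       V (x (negpm b)) <= V (x c)]; last first.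
  by move=> h; apply: (force_swap_direct xB ab bc) => //; right; clear -h; lia.
case/and3P: h => anb nbc xnb.
have hc : n <= V (x c) by clear -xbc xnb hxb; lia.
have [ec|nec] := eqVneq c (negpm b).
  by move: bc adj xbc; rewrite ec => *; apply: force_swap_mirror.
have {}nbc : V (negpm b) < V c by rewrite ltn_neqAle -V_eq eq_sym nec.
have anb' : a != negpm (negpm b) by rewrite negpmK V_eq; clear -ab; lia.
have cnb' : negpm b != negpm c by rewrite (inj_eq (@negpm_inj n)) V_eq; clear -bc; lia.
apply: (@move_force x a c (negpm b)) => //.
  by move=> _ _; rewrite negpmK; clear -xbc lt; lia.
move=> y yB yE Aad Adc.
have kb : move_key x c (negpm b) b = (4 * V (x (negpm c)))%N.
  by rewrite /move_key negpmK eqxx eq_sym negpm_neq.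
have hxc := V_Bn c xB.
have [bn|nb] := ltnP (V b) n.
  left; apply: force_swap_mirror => //; first by clear -bn lb; lia.
  by rewrite yE kb /move_key eqxx; clear -hxc hc; lia.
right; apply: (force_swap_direct yB _ bc Adc) => //.
- by clear -nb lb; lia.
- rewrite yE kb /move_key negpmK; case: eqP => [e|_]; first by clear -hxc hc; lia.
  case: eqP => [e|_]; first by move: bc; rewrite e ltnn.
  by clear -hxc hc; lia.
by right; rewrite ltnn.
Qed.

End ForceSwap.

(** * Class minima are exactly the avoiding elements *)

Section Main.
Variables (n : nat) (D : rel 'I_n).
Hypothesis Dor : orientation D.
Implicit Types (u v a b c d : pmn n) (w x y z : {perm pmn n}).

(** Closest positions work: an entry in between could replace [a] or [c], according to its side of
    [b]. *)
Lemma pattern_adjacent x b :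
  (exists a c, [&& V a < V b, V b < V c, V (x b) < V (x c) & V (x c) < V (x a)]) ->
  exists a c, [/\ V a < V b, V b < V c, V (x b) < V (x c) & adjacent x a c].
Proof.
case=> a0 [c0 h0].
pose P (p : pmn n * pmn n) :=
  [&& V p.1 < V b, V b < V p.2, V (x b) < V (x p.2) & V (x p.2) < V (x p.1)].
case: (@arg_minnP _ (a0, c0) P (fun p => V (x p.1) - V (x p.2)) h0) => -[a c]
  /and4P[/= ab bc xbc xca] hmin.
exists a, c; split=> //; split=> // v.
have [h|h] := leqP (V (x v)) (V (x c)); first by left.
have [h'|h'] := leqP (V (x a)) (V (x v)); first by right.
have nvb : V v != V b.
  by rewrite -V_eq (V_perm_eq x); clear -h xbc; lia.
exfalso; have [vb|bv] := ltnP (V v) (V b).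
  by have := hmin (v, c); rewrite /P /= vb bc xbc h; clear -h h'; lia.
by have := hmin (a, v); rewrite /P /= ab h' (ltn_trans xbc h) ltn_neqAle eq_sym nvb bv;
   clear -h h'; lia.
Qed.

(** At a violation, the contracted exchange is a smaller element of the class. *)
Lemma theta_min_avoid x : theta_min D x -> x \in Bn n /\ avoid (upper D) x.
Proof.
case=> xB xmin; split=> // a0 b c0 ab0 bc0 Ub iac.
rewrite /inverted bc0 /= ltnNge; apply/negP => h.
have [|a [c [ab bc xbc adj]]] := @pattern_adjacent x b.
  exists a0, c0; case/andP: iac => _ ->; rewrite ab0 bc0 andbT /=.
  by rewrite ltn_neqAle h andbT -(V_perm_eq x) V_eq; clear -bc0; lia.
have ac := ltn_trans ab bc; have yE u v := inverted_swap u v xB ac adj.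
have yB := swap_Bn a c xB.
have e : swap x a c = x.
  apply: xmin => //; last by apply/weak_le_iff => // u v; rewrite yE => /and3P[].
  by move=> R Rcong Rgen; apply: (force_swap_upper Dor Rcong _ xB ab bc adj).
by have := yE a c; rewrite e !eqxx andbF /inverted ac; case: adj => -> _.
Qed.

End Main.

Theorem theorem7p6 (n : nat) (D : rel 'I_n) :
  orientation D ->
  (forall x y m, theta_min D x -> theta_min D y -> is_meet x y m -> theta_min D m) /\
  (forall x y j, theta_min D x -> theta_min D y -> is_join x y j -> theta_min D j).
Proof.
move=> Dor; have UN := @upper_neg n D.
split=> [x y m|x y j] /(theta_min_avoid Dor)[xB xA] /(theta_min_avoid Dor)[yB yA] h.
  by apply: (avoid_theta_min Dor); [case: h | apply: avoid_meet h].
by apply: (avoid_theta_min Dor); [case: h | apply: (avoid_join UN xB yB)].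
Qed.
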